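(* Let $\mathbb M$ be a (connected) Carnot manifold whose local basis vector fields $X_1,\dots,X_N$ are of class $C^{1,\alpha}$ for some $\alpha\in(0,1]$. Then every two points $v,w$ of $\mathbb M$ can be joined by a rectifiable absolutely continuous horizontal curve $\gamma$ composed of not more than countably many segments of integral lines of the given horizontal fields.
   Context: Carnot manifold: $\mathbb M$ is a connected Riemannian $C^\infty$-manifold of dimension $N$ with Riemannian distance $\rho$, whose tangent bundle has a (horizontal) subbundle $H\mathbb M$ together with natural numbers $\dim H_1<\dots<\dim H_M=N$ such that each point $p\in\mathbb M$ has a neighborhood $U$ with $C^1$ vector fields $X_1,\dots,X_N$ on $U$ satisfying for every $v\in U$: (1) $X_1(v),\dots,X_N(v)$ is a basis of $T_v\mathbb M$; (2) $H_i(v)=\operatorname{span}\{X_1(v),\dots,X_{\dim H_i}(v)\}$ is a subspace of dimension $\dim H_i$, $i=1,\dots,M$, and $H_1(v)=H_v\mathbb M$; (3) $[X_i,X_j](v)=\sum_{\deg X_k\le\deg X_i+\deg X_j}c_{ijk}(v)X_k(v)$, where $\deg X_k=\min\{m\mid X_k\in H_m\}$; (4) the quotient mapping $[\cdot,\cdot]_0:H_1\times H_j/H_{j-1}\to H_{j+1}/H_j$ induced by Lie brackets is an epimorphism for all $1\le j<M$. $C^{1,\alpha}$ means $C^1$ with first derivatives locally $\alpha$-Hölder (with respect to $\rho$). The given horizontal fields are the fields $X_1,\dots,X_{\dim H_1}$ of the local bases. An absolutely continuous curve $\gamma:[0,a]\to\mathbb M$ is horizontal if $\dot\gamma(t)\in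 H_{\gamma(t)}\mathbb M$ for almost all $t\in[0,a]$. *)

(* Defs.v *)
(* Carnot manifolds, Riemannian distance and horizontal curves, on top of
   MathComp-Analysis. *)
From HB Require Import structures.
From mathcomp Require Import all_boot all_order all_algebra.
From mathcomp Require Import all_classical all_reals all_analysis.
Set Implicit Arguments.
Unset Strict Implicit.
Unset Printing Implicit Defensive.
Import Order.TTheory GRing.Theory Num.Theory.
Import numFieldNormedType.Exports.
Local Open Scope classical_set_scope.
Local Open Scope ring_scope.

(* Meant for open [A], on which the derivatives below are two-sided. *)
Fixpoint Ck_on (R : realType) (V W : normedModType R) (k : nat) (A : set V)
    (f : V -> W) : Prop :=
  match k with
  | 0 => forall x, A x -> {for x, continuous f}
  | k'.+1 => (forall x, A x -> differentiable f x) /\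
             (forall e : V, Ck_on k' A (fun x => 'D_e f x))
  end.

Definition Cinfty_on (R : realType) (V W : normedModType R) (A : set V)
    (f : V -> W) : Prop :=
  forall k, Ck_on k A f.

(* One chart is singled out around each point [p]; charts around different
   points may coincide, and a smooth atlas always yields such a family. *)
Record smooth_manifold (R : realType) (N : nat) (M : topologicalType) :=
  SmoothManifold {
    chart_dom : M -> set M ;
    chart : M -> M -> 'rV[R]_N ;
    chart_inv : M -> 'rV[R]_N -> M ;
    chart_domP : forall p, open (chart_dom p) /\ chart_dom p p ;
    chart_img_open : forall p, open (chart p @` chart_dom p) ;
    chartK : forall p v, chart_dom p v -> chart_inv p (chart p v) = v ;
    chart_continuous : forall p v, chart_dom p v ->
      {for v, continuous (chart p)} ;
    chart_inv_continuous : forall p x, (chart p @` chart_dom p) x ->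
      {for x, continuous (chart_inv p)} ;
    chart_smooth : forall p q,
      Cinfty_on (chart p @` (chart_dom p `&` chart_dom q))
                (chart q \o chart_inv p) ;
    manifold_hausdorff : hausdorff_space M ;
    manifold_second_countable : @second_countable M }.

(* A tangent vector at [v] is given by its coordinates in the chart singled out
   around [v], so that T_v M is the type 'rV[R]_N. *)
Definition vfield (R : realType) (N : nat) (M : topologicalType) : Type :=
  M -> 'rV[R]_N.

(* Coordinates in the chart around [q] of the tangent vector [xi] at [v]. *)
Definition tcoord (R : realType) (N : nat) (M : topologicalType)
    (A : smooth_manifold R N M) (q v : M) (xi : 'rV[R]_N) : 'rV[R]_N :=
  'D_xi (chart A q \o chart_inv A v) (chart A v v).

(* The tangent vector at [v] with coordinates [e] in the chart around [q]. *)
Definition tvec (R : realType) (N : nat) (M : topologicalType)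
    (A : smooth_manifold R N M) (q v : M) (e : 'rV[R]_N) : 'rV[R]_N :=
  'D_e (chart A v \o chart_inv A q) (chart A q v).

Definition local_field (R : realType) (N : nat) (M : topologicalType)
    (A : smooth_manifold R N M) (q : M) (X : vfield R N M) (x : 'rV[R]_N) :
    'rV[R]_N :=
  tcoord A q (chart_inv A q x) (X (chart_inv A q x)).

Definition C1_field (R : realType) (N : nat) (M : topologicalType)
    (A : smooth_manifold R N M) (U : set M) (X : vfield R N M) : Prop :=
  forall q, Ck_on 1 (chart A q @` (chart_dom A q `&` U)) (local_field A q X).

(* [X, Y] = X Y - Y X, computed at [v] in the chart around [v]. *)
Definition lie_bracket (R : realType) (N : nat) (M : topologicalType)
    (A : smooth_manifold R N M) (X Y : vfield R N M) : vfield R N M :=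
  fun v => 'D_(X v) (local_field A v Y) (chart A v v)
           - 'D_(Y v) (local_field A v X) (chart A v v).

Definition has_velocity (R : realType) (N : nat) (M : topologicalType)
    (A : smooth_manifold R N M) (c : R -> M) (t : R) (xi : 'rV[R]_N) : Prop :=
  is_derive t (1 : R) (chart A (c t) \o c) xi.

(* [gram v] is the Gram matrix of the scalar product on T_v M in the chart
   around [v]. *)
Record riemannian_metric (R : realType) (N : nat) (M : topologicalType)
    (A : smooth_manifold R N M) := RiemannianMetric {
  gram : M -> 'M[R]_N ;
  inner (v : M) (xi eta : 'rV[R]_N) : R := (xi *m gram v *m eta^T) 0 0 ;
  inner_sym : forall v xi eta, inner v xi eta = inner v eta xi ;
  inner_posdef : forall v xi, xi != 0 -> 0 < inner v xi xi ;
  inner_smooth : forall q (i j : 'I_N),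
    Cinfty_on (chart A q @` chart_dom A q)
      (fun x => inner (chart_inv A q x)
                  (tvec A q (chart_inv A q x) (delta_mx 0 i))
                  (tvec A q (chart_inv A q x) (delta_mx 0 j)) : R^o) }.

Definition C1_curve (R : realType) (N : nat) (M : topologicalType)
    (A : smooth_manifold R N M) (c : R -> M) : Prop :=
  continuous c /\
  forall q t, chart_dom A q (c t) ->
    derivable (chart A q \o c) t 1 /\
    {for t, continuous (derive1 (chart A q \o c))}.

Definition speed (R : realType) (N : nat) (M : topologicalType)
    (A : smooth_manifold R N M) (g : riemannian_metric A) (c : R -> M)
    (t : R) : R :=
  let xi := derive1 (chart A (c t) \o c) t in Num.sqrt (inner g (c t) xi xi).

(* The set below is nonempty when [M] is connected.  Replacing C^1 curves by
   piecewise C^1 ones does not change the infimum: reparametrize each piece so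
   that the velocity vanishes at the corners. *)
Definition riemannian_dist (R : realType) (N : nat) (M : topologicalType)
    (A : smooth_manifold R N M) (g : riemannian_metric A) (p q : M) : R :=
  inf [set l | exists c : R -> M,
    [/\ C1_curve A c, c 0 = p, c 1 = q &
        l = Rintegral lebesgue_measure `[0, 1] (speed g c)]].

Definition C1alpha_field (R : realType) (N : nat) (M : topologicalType)
    (A : smooth_manifold R N M) (g : riemannian_metric A) (alpha : R)
    (U : set M) (X : vfield R N M) : Prop :=
  C1_field A U X /\
  forall q p (i : 'I_N), chart_dom A q p -> U p ->
    exists W C, [/\ nbhs p W, W `<=` chart_dom A q `&` U &
      forall a b, W a -> W b ->
        `| 'D_(delta_mx 0 i) (local_field A q X) (chart A q a)
           - 'D_(delta_mx 0 i) (local_field A q X) (chart A q b) |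
        <= C * (riemannian_dist g a b) `^ alpha].

Definition frame_at (R : realType) (N : nat) (M : topologicalType)
    (X : 'I_N -> vfield R N M) (v : M) : N.-tuple 'rV[R]_N :=
  [tuple X i v | i < N].

(* H_j(v), the span of the first [dimH j] fields. *)
Definition filtration (R : realType) (N : nat) (M : topologicalType)
    (dimH : nat -> nat) (X : 'I_N -> vfield R N M) (j : nat) (v : M) :
    {vspace 'rV[R]_N} :=
  <<take (dimH j) (frame_at X v)>>%VS.

(* The degree of the [k]-th field, [k] counted from 0: the least [j] in
   {1, ..., m} with [k < dimH j], i.e. such that X_k is one of the fields
   spanning H_j. *)
Definition frame_deg (m : nat) (dimH : nat -> nat) (k : nat) : nat :=
  (find (fun j => (k < dimH j)%N) (iota 1 m)).+1.

Definition section_of (R : realType) (N : nat) (M : topologicalType)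
    (A : smooth_manifold R N M) (U : set M) (E : M -> {vspace 'rV[R]_N})
    (Y : vfield R N M) : Prop :=
  C1_field A U Y /\ forall v, U v -> Y v \in E v.

(* The last conjunct says that (Y(v), Z(v) + H_{j-1}(v)) |-> [Y, Z](v) + H_j(v)
   is an epimorphism from H_1 x H_j/H_{j-1} to H_{j+1}/H_j.  As the map is
   bilinear, this means that its image spans H_{j+1}/H_j (equivalently, that
   the induced linear map on the tensor product is onto). *)
Definition carnot_frame (R : realType) (N : nat) (M : topologicalType)
    (A : smooth_manifold R N M) (m : nat) (dimH : nat -> nat)
    (hor : M -> {vspace 'rV[R]_N}) (U : set M) (X : 'I_N -> vfield R N M) :
    Prop :=
  let H := filtration dimH X in
  let deg (k : 'I_N) := frame_deg m dimH k in
  [/\ forall i, C1_field A U (X i),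
      forall v, U v -> basis_of fullv (frame_at X v),
      forall v, U v ->
        (forall j, (1 <= j <= m)%N -> \dim (H j v) = dimH j) /\ H 1%N v = hor v,
      exists c : 'I_N -> 'I_N -> 'I_N -> M -> R, forall v, U v -> forall i j,
        lie_bracket A (X i) (X j) v =
        \sum_(k < N | (deg k <= deg i + deg j)%N) c i j k v *: X k v
    & forall v, U v -> forall j, (1 <= j < m)%N ->
        forall z, z \in H j.+1 v ->
        exists (n : nat) (Y Z : 'I_n -> vfield R N M),
          (forall l, section_of A U (H 1%N) (Y l) /\
                     section_of A U (H j) (Z l)) /\
          z - \sum_(l < n) lie_bracket A (Y l) (Z l) v \in H j v].

(* [dimH] is used on {1, ..., depth} only.  Around each point one local frame
   is singled out; the fields [frame p i] with [i < dimH 1] are the given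
   horizontal fields. *)
Record carnot_structure (R : realType) (N : nat) (M : topologicalType)
    (A : smooth_manifold R N M) := CarnotStructure {
  depth : nat ;
  dimH : nat -> nat ;
  hor : M -> {vspace 'rV[R]_N} ;
  frame_dom : M -> set M ;
  frame : M -> 'I_N -> vfield R N M ;
  depth_gt0 : (0 < depth)%N ;
  dimH_gt0 : (0 < dimH 1)%N ;
  dimH_lt : forall i j, (1 <= i)%N -> (i < j)%N -> (j <= depth)%N ->
    (dimH i < dimH j)%N ;
  dimH_depth : dimH depth = N ;
  frame_domP : forall p, open (frame_dom p) /\ frame_dom p p ;
  frameP : forall p, carnot_frame A depth dimH hor (frame_dom p) (frame p) }.

Definition abs_continuous_curve (R : realType) (M : Type) (rho : M -> M -> R)
    (a : R) (c : R -> M) : Prop :=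
  forall eps : R, 0 < eps -> exists2 delta : R, 0 < delta &
    forall (n : nat) (s t : 'I_n -> R),
      (forall k, [/\ 0 <= s k, s k <= t k & t k <= a]) ->
      trivIset setT (fun k => [set` `]s k, t k[]) ->
      \sum_(k < n) (t k - s k) < delta ->
      \sum_(k < n) rho (c (s k)) (c (t k)) < eps.

Definition rectifiable_curve (R : realType) (M : Type) (rho : M -> M -> R)
    (a : R) (c : R -> M) : Prop :=
  exists L : R, forall (n : nat) (t : nat -> R),
    0 <= t 0%N -> (forall k, (k < n)%N -> t k <= t k.+1) -> t n <= a ->
    \sum_(k < n) rho (c (t k)) (c (t k.+1)) <= L.

Definition horizontal_curve (R : realType) (N : nat) (M : topologicalType)
    (A : smooth_manifold R N M) (K : carnot_structure A) (a : R)
    (c : R -> M) : Prop :=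
  {ae (@lebesgue_measure R), forall t : R, t \in `[0, a] ->
    exists2 xi, has_velocity A c t xi & xi \in hor K (c t)}.

(* On [s, t] the curve runs along an integral line of [X] inside [U], in the
   direction of [X] or in the opposite one; a single point (s = t) is
   allowed. *)
Definition integral_segment (R : realType) (N : nat) (M : topologicalType)
    (A : smooth_manifold R N M) (U : set M) (X : vfield R N M) (c : R -> M)
    (s t : R) : Prop :=
  [/\ {within `[s, t], continuous c},
      forall r, r \in `[s, t] -> U (c r)
    & (forall r, r \in `]s, t[ -> has_velocity A c r (X (c r))) \/
      (forall r, r \in `]s, t[ -> has_velocity A c r (- X (c r)))].

(* The parameter interval is exactly the union of countably many segments
   without common interior points; repeated one-point segments cover the finite
   case and the accumulation points of segments. *)
Definition composed_of_countably_many_segments (R : realType) (N : nat)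
    (M : topologicalType) (A : smooth_manifold R N M)
    (K : carnot_structure A) (a : R) (c : R -> M) : Prop :=
  exists s t : nat -> R,
    [/\ forall n, s n <= t n,
        trivIset setT (fun n => [set` `]s n, t n[]),
        \bigcup_n [set` `[s n, t n]] = [set` `[0, a]]
      & forall n, exists (p : M) (i : 'I_N), (i < dimH K 1)%N /\
          integral_segment A (frame_dom K p) (frame K p i) c (s n) (t n)].

(* Main.v *)
Require Import Defs.
From HB Require Import structures.
From mathcomp Require Import all_boot all_order all_algebra.
From mathcomp Require Import all_classical all_reals all_analysis.
From mathcomp Require Import ring lra.
Import Order.TTheory GRing.Theory Num.Theory.
Import numFieldNormedType.Exports.
Local Open Scope classical_set_scope.
Local Open Scope ring_scope.
Set Implicit Arguments.
Unset Strict Implicit.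
Unset Printing Implicit Defensive.

(** The horizontal fields may be followed in both directions, so being joined
    by finitely many integral segments is an equivalence relation on the
    manifold.  Its classes are shown to be open; by connectedness there is then
    only one class, and the finitely many segments are completed by one-point
    segments to a countable family.

    Openness is a matter of moving from a point [x0] in all directions.  A
    direction [v] is called movable at [x0] if for every [e > 0] there is a
    family of maps [m s], [s] near 0, which move points along reachable pairs,
    with [m 0 x0 = x0] and
      [|m s x - m s' x' - (x - x') - (s - s') v| <= e (|x - x'| + |s - s'|)]
    near [(0, x0)]: up to [e], [m] is strictly differentiable there with
    derivative [(s, x) |-> x + s v].  Such families can be composed, so the
    movable directions form a vector space, and if this is the whole tangent
    space, an inverse function argument (Newton iteration, for which
    approximate strict differentiability is enough) yields a neighbourhood of
    reachable points ([movable_open]).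

    The value of a horizontal field [f] is movable by its flow
    ([movable_flow]).  If [g] is a field whose values near [x0] are movable, then
    [[f, g]] is movable at [x0] ([movable_bracket]): moving along [g] at the
    point [phi tau x0], conjugated by the flow [phi tau] of [f] and preceded
    by the opposite of the move along [g] at [x0], is a move in the direction
    [tau [f, g] + o(tau)] with error [o(tau)], and dividing the parameter by
    [tau] gives the bracket with error [o(1)].  Of the flow only
    the first order behaviour at the single point [x0] enters, which is read off
    from the differential equation ([local_flow]); and [g] may itself come
    from brackets, since its own flow does not occur.

    Going up the filtration ([mov_frame]), a vector of [H_(j+1)] is, modulo
    [H_j], a sum of brackets of sections of [H_1] and of [H_j]; these
    reduce to brackets of frame fields, because differentiating the coefficients
    of a section only produces terms that stay in [H_1] or [H_j]
    ([derive_in_span]).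

    For the metric properties every segment is shown to be Lipschitz for the
    Riemannian distance.  Instead of the triangle inequality for that
    distance, curves which are at rest at both ends are used: they can be
    concatenated within the class of C^1 curves ([joined_trans]). *)

(** * Row vectors, mean value inequality and primitives *)

Section basics.
Variables (R : realType).
Implicit Types (n k m : nat).

Lemma rv_norm_le n (x : 'rV[R]_n) (c : R) :
  0 <= c -> (forall i, `|x 0 i| <= c) -> `|x| <= c.
Proof.
move=> c0 h; rewrite [leLHS]/Num.Def.normr/= mx_normrE.
by apply/bigmax_leP; split=> // -[i j] _ /=; rewrite ord1.
Qed.

Lemma rv_coord_le n (x : 'rV[R]_n) i : `|x 0 i| <= `|x|.
Proof.
rewrite [leRHS]/Num.Def.normr/= mx_normrE.
exact: (le_bigmax _ (fun ij : 'I_1 * 'I_n => `|x ij.1 ij.2|) (ord0, i)).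
Qed.

(** A bound for the operator norm of [x |-> x *m A]. *)
Definition opnorm m n (A : 'M[R]_(m, n)) : R := \sum_i `|row i A|.

Lemma opnorm_ge0 m n (A : 'M[R]_(m, n)) : 0 <= opnorm A.
Proof. exact: sumr_ge0. Qed.

Lemma mulmx_norm_le m n (A : 'M[R]_(m, n)) (x : 'rV_m) :
  `|x *m A| <= opnorm A * `|x|.
Proof.
rewrite mulmx_sum_row (le_trans (ler_norm_sum _ _ _))// /opnorm mulr_suml.
apply: ler_sum => i _; rewrite normrZ mulrC ler_wpM2l//.
exact: rv_coord_le.
Qed.

(** Increments dominated by a geometric sequence, the form in which completeness
    is used for the Picard iteration and for the Newton iteration. *)
Lemma geometric_increments_cvg n (u : nat -> 'rV[R]_n) (C : R) :
  (forall k, `|u k.+1 - u k| <= C / 2 ^+ k) ->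
  exists l : 'rV[R]_n, u @ \oo --> l /\ forall k, `|l - u k| <= 2 * C / 2 ^+ k.
Proof.
move=> hu.
have C0 : 0 <= C by have := le_trans (normr_ge0 _) (hu 0%N); rewrite expr0 divr1.
have hd k p : `|u (k + p)%N - u k| <= 2 * C / 2 ^+ k - 2 * C / 2 ^+ (k + p).
  elim: p => [|p IH]; first by rewrite addn0 !subrr normr0.
  rewrite addnS -(subrKA (u (k + p)%N)) (le_trans (ler_normD _ _))//.
  rewrite (le_trans (lerD (hu _) IH))// exprS invfM.
  have : 2^-1 * 2 = 1 :> R by rewrite mulVf.
  by move: (2 ^+ (k + p))^-1 => y; lra.
have hd' k p : (k <= p)%N -> `|u p - u k| <= 2 * C / 2 ^+ k.
  move=> kp; rewrite -(subnKC kp) (le_trans (hd _ _))// gerBl.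
  by rewrite divr_ge0 ?exprn_ge0// mulr_ge0.
have small (e : R) : 0 < e -> exists k, 2 * C / 2 ^+ k < e.
  move=> e0; have := @cvg_geometric R (2 * C) 2^-1.
  rewrite ger0_norm ?invr_ge0// invf_lt1// ltr1n => /(_ erefl).
  move/cvgrPdist_lt => /(_ _ e0)[k _ /(_ k (leqnn _))].
  rewrite /= sub0r normrN ger0_norm; last first.
    by rewrite /geometric /= mulr_ge0 ?mulr_ge0// exprn_ge0// invr_ge0.
  by rewrite /geometric/= exprVn; exists k.
have /cauchy_cvgP ul : cauchy (u @ \oo).
  apply/cauchy_ballP => e e0; near_simpl.
  have [k ke] := small (e / 2) (divr_gt0 e0 (ltr0Sn _ 1)).
  exists ([set p | k <= p]%N, [set p | k <= p]%N); first by split; exists k.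
  move=> [p q] [/= kp kq].
  have := hd' _ _ kp; have := hd' _ _ kq => h1 h2.
  rewrite mx_norm_ball /ball_ /= -(subrKA (u k)) (le_lt_trans (ler_normD _ _))//.
  by rewrite [X in _ + X < _]distrC; lra.
exists (lim (u @ \oo)); split=> // k.
apply/ler_addgt0Pr => e e0.
move/cvgrPdist_le : ul => /(_ _ e0)[K _ hK].
have := hK (maxn k K) (leq_maxr _ _) => {}hK.
rewrite -(subrKA (u (maxn k K))) (le_trans (ler_normD _ _))//.
by rewrite addrC lerD// hd'// leq_maxl.
Qed.

Lemma is_derive_coord n (u : R -> 'rV[R]_n) t (d : 'rV_n) i :
  is_derive t (1 : R) u d -> is_derive t (1 : R) (fun s => u s 0 i) (d 0 i).
Proof.
move=> [ud ue]; apply: DeriveDef; first by move/derivable_mxP : ud => /(_ 0 i).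
by rewrite -ue derive_mx// mxE.
Qed.

Lemma is_derive_rv n (u : R -> 'rV[R]_n) t (d : 'rV_n) :
  (forall i, is_derive t (1 : R) (fun s => u s 0 i) (d 0 i)) -> is_derive t (1 : R) u d.
Proof.
move=> h; have ud : derivable u t 1.
  by apply/derivable_mxP => i j; rewrite ord1; case: (h j).
by apply: DeriveDef => //; rewrite derive_mx//; apply/rowP => i; rewrite mxE;
  case: (h i).
Qed.

Lemma is_derive_cts n (u : R -> 'rV[R]_n) t (d : 'rV_n) :
  is_derive t (1 : R) u d -> {for t, continuous u}.
Proof. by move=> [/derivable1_diffP /differentiable_continuous]. Qed.

(** Mean value inequality, coordinatewise because the norm is the maximum
    norm. *)
Lemma mean_value_le n (u du : R -> 'rV[R]_n) (a b C : R) : a <= b ->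
  (forall t, t \in `[a, b] -> is_derive t (1 : R) u (du t)) ->
  (forall t, t \in `[a, b] -> `|du t| <= C) ->
  `|u b - u a| <= C * (b - a).
Proof.
move=> ab hd hC.
have C0 : 0 <= C.
  by apply: le_trans (hC a _); rewrite ?normr_ge0// in_itv/= lexx.
have ba : 0 <= b - a by rewrite subr_ge0.
apply: rv_norm_le; first exact: mulr_ge0.
move=> i; rewrite !mxE.
have hi t : t \in `[a, b] -> is_derive t (1 : R) (fun s => u s 0 i) (du t 0 i).
  by move=> /hd; exact: is_derive_coord.
have ci : {within `[a, b], continuous (fun s => u s 0 i)}.
  by apply: derivable_within_continuous => x xab; case: (hi x xab).
have di t : t \in `]a, b[ -> is_derive t (1 : R) (fun s => u s 0 i) (du t 0 i).
  by move=> tab; apply: hi; move: tab; apply: subset_itv_oo_cc.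
have [c cab ->] := MVT_segment ab di ci.
rewrite normrM (ger0_norm ba) ler_wpM2r//.
exact: le_trans (rv_coord_le _ _) (hC _ cab).
Qed.

Lemma mean_value_dist n (u du : R -> 'rV[R]_n) (T C : R) :
  (forall t, `|t| <= T -> is_derive t (1 : R) u (du t)) ->
  (forall t, `|t| <= T -> `|du t| <= C) ->
  forall s t, `|s| <= T -> `|t| <= T -> `|u t - u s| <= C * `|t - s|.
Proof.
move=> hd hC s t; wlog st : s t / s <= t => [hw|] sT tT.
  have [st|/ltW ts] := leP s t; first exact: hw.
  by rewrite distrC (distrC t); exact: hw.
have sub r : r \in `[s, t] -> `|r| <= T.
  by rewrite in_itv/= => /andP[? ?]; move: sT tT; rewrite !ler_norml; lra.
rewrite [`|t - s|]ger0_norm ?subr_ge0//.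
by apply: (@mean_value_le _ u du) => // r /sub; [exact: hd|exact: hC].
Qed.

Lemma primitive1 (f : R -> R) (T : R) : continuous f ->
  exists F : R -> R, F 0 = 0 /\ forall t, `|t| <= T -> is_derive t (1 : R) F (f t).
Proof.
move=> cf; pose a := - `|T| - 1; pose b := `|T| + 1.
pose F x := (\int[@lebesgue_measure R]_(t in `[a, x]) f t)%R.
exists (fun x => F x - F 0); split=> [|t tT]; first exact: subrr.
have tb : t < b /\ a < t.
  have := le_trans tT (ler_norm T); rewrite ler_norml /a /b; lra.
have fi : (@lebesgue_measure R).-integrable `[a, b] (EFin \o f).
  apply: continuous_compact_integrable; first exact: segment_compact.
  by apply: continuous_subspaceT.
have [dF eF] := continuous_FTC1_closed tb.1 fi tb.2 (cf t).
have hF : is_derive t (1 : R) F (f t) by apply: (DeriveDef dF); rewrite -eF derive1E.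
by apply: is_derive_eq; rewrite subr0.
Qed.

Lemma primitive n (f : R -> 'rV[R]_n) (T : R) : continuous f ->
  exists F : R -> 'rV[R]_n,
    F 0 = 0 /\ forall t, `|t| <= T -> is_derive t (1 : R) F (f t).
Proof.
move=> cf.
have hf i : exists F : R -> R,
    F 0 = 0 /\ forall t, `|t| <= T -> is_derive t (1 : R) F (f t 0 i).
  apply: (@primitive1 (fun t => f t 0 i)) => t.
  exact: continuous_comp (cf t) (@coord_continuous R 1 n 0 i (f t)).
have [F hF] := choice hf.
exists (fun t => \row_i F i t); split=> [|t tT].
  by apply/rowP => i; rewrite !mxE (hF i).1.
apply: is_derive_rv => i.
rewrite (_ : (fun s => _) = F i); first exact: (hF i).2.
by apply/funext => s; rewrite mxE.
Qed.

End basics.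

(** * Ordinary differential equations *)

Section ode.
Variables (R : realType) (n : nat).
Local Notation V := 'rV[R]_n.

Definition truncate (r t : R) : R := Num.max (- r) (Num.min r t).

Lemma truncate_lip r s t : `|truncate r s - truncate r t| <= `|s - t|.
Proof.
rewrite /truncate ler_norml; have := ler_norm (s - t).
have := ler_norm (t - s); rewrite (distrC t).
by case: (leP r s) => ?; case: (leP r t) => ?; case: (leP (- r) r) => ?;
  case: (leP (- r) s) => ?; case: (leP (- r) t) => ?; lra.
Qed.

Lemma truncate_le r t : 0 <= r -> `|truncate r t| <= r.
Proof.
rewrite /truncate ler_norml => r0.
by case: (leP r t) => ?; case: (leP (- r) r) => ?; case: (leP (- r) t) => ?; lra.
Qed.

Lemma truncate_id r t : `|t| <= r -> truncate r t = t.
Proof.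
rewrite /truncate ler_norml => /andP[? ?].
by case: (leP r t) => ?; case: (leP (- r) r) => ?; case: (leP (- r) t) => ?; lra.
Qed.

Lemma is_derive_sub (u v : R -> V) t a b :
  is_derive t (1 : R) u a -> is_derive t (1 : R) v b ->
  is_derive t (1 : R) (fun s => u s - v s) (a - b).
Proof. by move=> ? ?; exact: is_deriveB. Qed.

Lemma near_dist_le (W : normedModType R) (x : W) (e : R) :
  0 < e -> \forall y \near x, `|x - y| <= e.
Proof. by move=> e0; apply: cvgr_dist_le => //; exact: cvg_id. Qed.

Lemma truncate_continuous r : continuous (truncate r).
Proof.
move=> t; apply/cvgrPdist_le => e e0; near=> s.
apply: le_trans (truncate_lip _ _ _) _.
by near: s; apply: cvgr_dist_le => //; exact: cvg_id.
Unshelve. all: by end_near. Qed.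

Lemma lip_continuous (W W' : normedModType R) (F : W -> W') (K : R) :
  (forall x y, `|F x - F y| <= K * `|x - y|) -> continuous F.
Proof.
move=> lipF x; apply/cvgrPdist_le => e e0; near=> y.
have K1 : K <= `|K| + 1 by have := ler_norm K; lra.
have K0 : 0 < `|K| + 1 by have := normr_ge0 K; lra.
apply: le_trans (lipF _ _) _.
apply: (@le_trans _ _ ((`|K| + 1) * `|x - y|)); first exact: ler_wpM2r.
rewrite -ler_pdivlMl//; near: y; apply: near_dist_le.
by rewrite mulr_gt0// invr_gt0.
Unshelve. all: by end_near. Qed.

(** Picard iteration. The iterates live on the whole line, their time argument
    being truncated to [-T, T], so that no function space has to be set up. *)
Lemma ode_exists (F : V -> V) (K T : R) (x : V) :
  (forall y z, `|F y - F z| <= K * `|y - z|) -> 0 <= T -> K * T <= 2^-1 ->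
  exists u : R -> V, u 0 = x /\
    forall t, `|t| <= T -> is_derive t (1 : R) u (F (u t)).
Proof.
move=> lipF T0 KT; have cF := lip_continuous lipF.
have /choice[P hP] (f : R -> V) : exists G : R -> V, continuous f -> G 0 = 0 /\
    forall t, `|t| <= T -> is_derive t (1 : R) G (f t).
  have [cf|ncf] := pselect (continuous f); last by exists f.
  by have [G hG] := primitive T cf; exists G.
pose step (w : R -> V) : R -> V := fun t => x + P (F \o w) (truncate T t).
have cFw (w : R -> V) : continuous w -> continuous (F \o w).
  by move=> cw t; exact: (@continuous_comp R V V w F t (cw t) (cF (w t))).
have cstep (w : R -> V) : continuous w -> continuous (step w).
  move=> cw t; have [_ hd] := hP _ (cFw _ cw).
  have c2 := is_derive_cts (hd _ (truncate_le t T0)).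
  have c3 := continuous_comp (@truncate_continuous T t) c2.
  exact: (cvgD (cvg_cst x) c3).
pose w k := iter k step (cst x).
have cw k : continuous (w k).
  by elim: k => [|k IH]; [exact: cst_continuous|exact: cstep].
(* the integral operator halves uniform distances *)
have contr (a b : R -> V) D : continuous a -> continuous b -> 0 <= D ->
    (forall t, `|t| <= T -> `|a t - b t| <= D) ->
    forall t, `|t| <= T -> `|P (F \o a) t - P (F \o b) t| <= D / 2.
  move=> ca cb D0 hab t tT.
  have [a0 ha] := hP _ (cFw _ ca); have [b0 hb] := hP _ (cFw _ cb).
  have := @mean_value_dist R n (fun s => P (F \o a) s - P (F \o b) s)
    (fun s => F (a s) - F (b s)) T (`|K| * D) _ _ 0 t.
  rewrite a0 b0 !subr0 normr0 => /(_ _ _ T0 tT) => h.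
  have {h} : `|P (F \o a) t - P (F \o b) t| <= `|K| * D * `|t|.
    apply: h => s sT.
      exact: (is_derive_sub (ha _ sT) (hb _ sT)).
    apply: le_trans (lipF _ _) _.
    apply: (@le_trans _ _ (`|K| * `|a s - b s|)).
      by rewrite ler_wpM2r// ler_norm.
    by rewrite ler_wpM2l// hab.
  have [K0|K0] := leP 0 K.
    rewrite ger0_norm// => /le_trans; apply.
    apply: (@le_trans _ _ (K * D * T)); first by rewrite ler_wpM2l// mulr_ge0.
    by rewrite mulrAC mulrC ler_wpM2l.
  move=> _.
  have -> : P (F \o a) t = P (F \o b) t; last by rewrite subrr normr0 divr_ge0.
  (* a negative Lipschitz constant forces F to be constant *)
  have Fab : F \o a = F \o b.
    apply/funext => s /=; apply/eqP; rewrite -subr_eq0 -normr_eq0.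
    rewrite eq_le normr_ge0 andbT (le_trans (lipF _ _))//.
    by rewrite nmulr_rle0.
  by rewrite Fab.
pose C := `|F x| * T.
have C0 : 0 <= C by rewrite mulr_ge0.
have incr k t : `|w k.+1 t - w k t| <= C / 2 ^+ k.
  elim: k t => [|k IH] t.
    rewrite expr0 divr1 /w/= /step /= addrAC subrr add0r.
    have [P0 dP] := hP _ (cFw _ (cw 0%N)).
    have tT := truncate_le t T0.
    have := @mean_value_dist R n _ _ T `|F x| dP _ 0 (truncate T t).
    rewrite P0 !subr0 normr0 => /(_ _ T0 tT) => h.
    by apply: le_trans (h _) _ => //; rewrite ler_wpM2l.
  rewrite /w/= -/(w k) /step opprD addrACA subrr add0r.
  rewrite exprSr invfM mulrA; apply: (contr (step (w k)) (w k)) => //.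
  - exact: (cw k.+1).
  - by rewrite divr_ge0// exprn_ge0.
  - by move=> s _; exact: IH.
  - exact: truncate_le.
have /choice[W hW] t := geometric_increments_cvg (incr^~ t).
have hWk t k : `|W t - w k t| <= 2 * C / 2 ^+ k by case: (hW t).
have small (e : R) : 0 < e -> exists k, 2 * C / 2 ^+ k <= e.
  move=> e0; have := @cvg_geometric R (2 * C) 2^-1.
  rewrite ger0_norm ?invr_ge0// invf_lt1// ltr1n => /(_ erefl).
  move/cvgrPdist_le => /(_ _ e0)[k _ /(_ k (leqnn _))].
  rewrite /= sub0r normrN => /(le_trans (ler_norm _)).
  by rewrite /geometric/= exprVn; exists k.
have cW : continuous W.
  move=> t; apply/cvgrPdist_le => e e0.
  have [k hk] := small (e / 3) (divr_gt0 e0 (ltr0Sn _ 2)).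
  near=> s.
  have h1 := le_trans (hWk t k) hk; have h2 := le_trans (hWk s k) hk.
  have h3 : `|w k t - w k s| <= e / 3.
    by near: s; apply: cvgr_dist_le; [exact: cw|exact: divr_gt0].
  rewrite -(subrKA (w k t)) -[X in _ + X](subrKA (w k s)).
  rewrite (le_trans (ler_normD _ _))// [leRHS](_ : _ = e / 3 + (e / 3 + e / 3)).
    rewrite lerD// (le_trans (ler_normD _ _))// lerD//.
    by rewrite distrC.
  by lra.
(* the limit and the integral curve it generates agree on [-T, T] only *)
have [P0 dP] := hP _ (cFw _ cW).
have PW t : `|t| <= T -> x + P (F \o W) t = W t.
  move=> tT; apply/eqP; rewrite -subr_eq0 -normr_eq0 eq_le normr_ge0 andbT.
  apply/ler_addgt0Pr => e e0; rewrite add0r.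
  have [k hk] := small (e / 2) (divr_gt0 e0 (ltr0Sn _ 1)).
  rewrite -(subrKA (w k.+1 t)) (le_trans (ler_normD _ _))//.
  rewrite [e](splitr e) lerD//.
    rewrite /w/= -/(w k) /step truncate_id// opprD addrACA subrr add0r.
    apply: (le_trans (contr W (w k) (e / 2) _ _ _ _ t tT)) => //.
    - by lra.
    - by move=> s _; exact: le_trans (hWk _ _) hk.
    - by lra.
  rewrite distrC; apply: le_trans (hWk _ _) (le_trans _ hk).
  rewrite ler_wpM2l ?mulr_ge0// lef_pV2 ?posrE ?exprn_gt0//.
  by rewrite exprS ler_peMl ?exprn_ge0// ler1n.
exists (fun t => x + P (F \o W) t); split=> [|t tT]; first by rewrite P0 addr0.
rewrite PW//; have := dP _ tT => /= ?.
by apply: is_derive_eq; rewrite add0r.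
Unshelve. all: by end_near. Qed.

(** The distance of two solutions attains its maximum on [-T, T], and as
    [K * T <= 1 / 2] this maximum exceeds the initial distance by at most half of
    itself. *)
Lemma ode_stable (F : V -> V) (K T : R) (u v : R -> V) :
  (forall y z, `|F y - F z| <= K * `|y - z|) -> 0 <= T -> 0 <= K ->
  K * T <= 2^-1 ->
  (forall t, `|t| <= T -> is_derive t (1 : R) u (F (u t))) ->
  (forall t, `|t| <= T -> is_derive t (1 : R) v (F (v t))) ->
  forall t, `|t| <= T -> `|u t - v t| <= 2 * `|u 0 - v 0|.
Proof.
move=> lipF T0 K0 KT du dv.
have duv t : `|t| <= T ->
    is_derive t (1 : R) (fun s => u s - v s) (F (u t) - F (v t)).
  by move=> tT; exact: (is_derive_sub (du _ tT) (dv _ tT)).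
have TT : - T <= T by lra.
have inT t : `|t| <= T -> t \in `[- T, T] by rewrite in_itv/= ler_norml.
have Tin t : t \in `[- T, T] -> `|t| <= T by rewrite in_itv/= ler_norml.
have [|c cT hc] := @EVT_max R (fun t => `|u t - v t|) (- T) T TT.
  apply: continuous_in_subspaceT => t /[!inE]/= tT.
  apply: continuous_comp; last exact: norm_continuous.
  exact: (is_derive_cts (duv t (Tin t tT))).
move=> t tT; apply: le_trans (hc _ (inT _ tT)) _.
set S := `|u c - v c|.
have S0 : 0 <= S by exact: normr_ge0.
have : `|(u c - v c) - (u 0 - v 0)| <= K * S * `|c - 0|.
  apply: (@mean_value_dist R n (fun s => u s - v s)
     (fun s => F (u s) - F (v s)) T); rewrite ?normr0//; last exact: Tin.
  move=> s sT; apply: le_trans (lipF _ _) _.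
  by rewrite ler_wpM2l//; exact: hc (inT _ sT).
rewrite subr0 => h.
have h2 : K * S * `|c| <= S / 2.
  apply: (@le_trans _ _ (K * S * T)).
    by rewrite ler_wpM2l ?mulr_ge0//; exact: Tin.
  by rewrite mulrAC mulrC ler_wpM2l.
have := ler_normD (u c - v c - (u 0 - v 0)) (u 0 - v 0); rewrite subrK -/S.
lra.
Qed.

End ode.

(** * Local flows *)

Section flow.
Variables (R : realType) (n : nat).
Local Notation V := 'rV[R]_n.

Definition strictly_diff (f : V -> V) (x0 : V) (A : 'M[R]_n) : Prop :=
  forall w : R, 0 < w -> exists2 r : R, 0 < r &
    forall x y, `|x - x0| <= r -> `|y - x0| <= r ->
      `|f x - f y - (x - y) *m A| <= w * `|x - y|.

(** The retraction onto a ball, 1-Lipschitz for the maximum norm; composing a field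
    with it makes the field globally Lipschitz. *)
Definition truncate_rv (x0 : V) (r : R) (x : V) : V :=
  \row_i (x0 0 i + truncate r (x 0 i - x0 0 i)).

Lemma truncate_rv_lip x0 r x y :
  `|truncate_rv x0 r x - truncate_rv x0 r y| <= `|x - y|.
Proof.
apply: rv_norm_le => // i; rewrite !mxE opprD addrACA subrr add0r.
apply: le_trans (truncate_lip _ _ _) _; rewrite opprB addrA subrK.
by have := rv_coord_le (x - y) i; rewrite !mxE.
Qed.

Lemma truncate_rv_le x0 r x : 0 <= r -> `|truncate_rv x0 r x - x0| <= r.
Proof.
move=> r0; apply: rv_norm_le => // i; rewrite !mxE addrAC subrr add0r.
exact: truncate_le.
Qed.

Lemma truncate_rv_id x0 r x : `|x - x0| <= r -> truncate_rv x0 r x = x.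
Proof.
move=> xr; apply/rowP => i; rewrite mxE truncate_id ?subrKC//.
by apply: le_trans xr; have := rv_coord_le (x - x0) i; rewrite !mxE.
Qed.

Lemma is_derive_lin (v : V) (t : R) : is_derive t (1 : R) (fun s => s *: v) v.
Proof.
apply: is_derive_rv => i.
rewrite (_ : (fun s => _) = (fun s : R => s * v 0 i)); last first.
  by apply/funext => s; rewrite mxE.
apply: is_derive_eq. by rewrite scaler0 add0r [LHS]mulr1.
Qed.

(** The local flow of a field that is strictly differentiable at one point.  The
    dependence on the initial point is of first order only: near x0 the time t
    map differs from 1 + t A by a Lipschitz map whose constant is a small
    multiple of t, as one sees by differentiating the difference of two
    solutions minus its linear part. *)
Lemma local_flow (f : V -> V) (x0 : V) (A : 'M[R]_n) (w rho : R) :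
  strictly_diff f x0 A -> 0 < w -> 0 < rho ->
  exists r T : R, exists phi : R -> V -> V, [/\ 0 < r, 0 < T &
   forall x, `|x - x0| <= r ->
   [/\ phi 0 x = x,
       forall t, `|t| <= T -> is_derive t (1 : R) (phi^~ x) (f (phi t x)) /\
                              `|phi t x - x0| <= rho,
       forall t y, `|t| <= T -> `|y - x0| <= r ->
         `|phi t x - phi t y - (x - y) - t *: ((x - y) *m A)|
           <= `|t| * w * `|x - y|,
       forall s t, `|s| <= T -> `|t| <= T ->
         `|phi t x - phi s x - (t - s) *: f x0| <= w * `|t - s|
     & forall t, `|t| <= T -> phi (- t) (phi t x) = x]].
Proof.
move=> df w0 rho0.
pose a := opnorm A; have a0 : 0 <= a := opnorm_ge0 A.
pose K := a + 1; have K0 : 0 < K by rewrite /K; lra.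
pose w1 := Num.min 1 (w / 4).
have w10 : 0 < w1 by rewrite /w1 lt_min ltr01/= divr_gt0.
have w11 : w1 <= 1 by rewrite /w1 ge_min lexx.
have w14 : w1 <= w / 4 by rewrite /w1 ge_min lexx orbT.
have [r0 r00 hr0] := df _ w10.
pose r1 := Num.min r0 (Num.min rho (w / K)).
have r10 : 0 < r1 by rewrite /r1 !lt_min r00 rho0 divr_gt0.
have r1r0 : r1 <= r0 by rewrite /r1 ge_min lexx.
have r1rho : r1 <= rho by rewrite /r1 !ge_min lexx orbT.
have r1w : K * r1 <= w.
  by rewrite mulrC -ler_pdivlMr// /r1 !ge_min lexx !orbT.
pose F x := f (truncate_rv x0 r1 x).
have lipf x y : `|x - x0| <= r1 -> `|y - x0| <= r1 ->
    `|f x - f y| <= K * `|x - y|.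
  move=> xr yr; have := hr0 x y (le_trans xr r1r0) (le_trans yr r1r0) => h.
  have h2 := mulmx_norm_le A (x - y).
  rewrite -[f x - f y](subrK ((x - y) *m A)) (le_trans (ler_normD _ _))//.
  rewrite /K mulrDl mul1r addrC lerD//.
  by apply: le_trans h _; rewrite ler_piMl.
have lipF x y : `|F x - F y| <= K * `|x - y|.
  apply: (@le_trans _ _ (K * `|truncate_rv x0 r1 x - truncate_rv x0 r1 y|)).
    by apply: lipf; apply: truncate_rv_le; exact: ltW.
  by rewrite ler_wpM2l ?truncate_rv_lip// ltW.
have FE x : `|x - x0| <= r1 -> F x = f x by move=> h; rewrite /F truncate_rv_id.
pose B := `|f x0| + w.
have B0 : 0 < B by rewrite /B; have := normr_ge0 (f x0); lra.
have FB x : `|F x - f x0| <= w.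
  have x0r : `|x0 - x0| <= r1 by rewrite subrr normr0 ltW.
  apply: le_trans (lipf _ _ (truncate_rv_le _ _ (ltW r10)) x0r) _.
  apply: le_trans r1w; rewrite ler_wpM2l ?(ltW K0)//.
  by apply: truncate_rv_le; exact: ltW.
(* T makes the Picard map a contraction, keeps the solutions in the ball of
   radius r1, and makes the error of the linearization less than w *)
pose T := Num.min (4 * K)^-1 (Num.min (r1 / (2 * B)) (w / (4 * a * K + 1))).
have aK : 0 <= 4 * a * K by rewrite !mulr_ge0// ltW.
have D0 : 0 < 4 * a * K + 1 by lra.
have T0 : 0 < T.
  by rewrite /T !lt_min invr_gt0 !divr_gt0 ?mulr_gt0.
have T1 : K * (2 * T) <= 2^-1.
  have : T <= (4 * K)^-1 by rewrite /T ge_min lexx.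
  by rewrite -[_^-1]mul1r ler_pdivlMr ?mulr_gt0//; lra.
have T2 : B * T <= r1 / 2.
  have : T <= r1 / (2 * B) by rewrite /T !ge_min lexx orbT.
  by rewrite ler_pdivlMr ?mulr_gt0//; lra.
have T3 : 2 * (a * K) * T <= w / 2.
  have : T <= w / (4 * a * K + 1) by rewrite /T !ge_min lexx !orbT.
  rewrite ler_pdivlMr//; lra.
have TT t : `|t| <= T -> `|t| <= 2 * T by lra.
have T20 : 0 <= 2 * T by lra.
have /choice[u hu] x := ode_exists x lipF T20 T1.
have uder x t : `|t| <= 2 * T -> is_derive t (1 : R) (u x) (F (u x t)).
  by case: (hu x) => _; exact.
have u00 x : u x 0 = x by case: (hu x).
have stay x t : `|t| <= T -> `|u x t - x| <= r1 / 2.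
  move=> tT; rewrite -[X in _ - X](u00 x).
  apply: le_trans T2; apply: (@le_trans _ _ (B * `|t - 0|)); last first.
    by rewrite subr0 ler_wpM2l// ltW.
  apply: (@mean_value_dist R n _ (fun t => F (u x t)) T) => //.
  - by move=> s sT; exact/uder/TT.
  - move=> s sT; rewrite -[F _](subrK (f x0)) (le_trans (ler_normD _ _))//.
    by rewrite addrC lerD// FB.
  - by rewrite normr0 ltW.
have stab x y t : `|t| <= T -> `|u x t - u y t| <= 2 * `|x - y|.
  move=> /TT tT; rewrite -{2}(u00 x) -{2}(u00 y).
  exact: (ode_stable lipF T20 (ltW K0) T1 (uder x) (uder y) tT).
exists (r1 / 2), T, (fun t x => u x t); split=> //; first by lra.
have stayr x t : `|x - x0| <= r1 / 2 -> `|t| <= T -> `|u x t - x0| <= r1.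
  move=> xr tT; rewrite -(subrKA x) (le_trans (ler_normD _ _))//.
  by have := stay x t tT; lra.
move=> x xr; split=> //.
- move=> t tT; rewrite -FE; last exact: stayr.
  by split; [exact/uder/TT|exact: le_trans (stayr x t xr tT) r1rho].
- move=> t y tT yr.
  pose psi s := u x s - u y s - s *: ((x - y) *m A).
  have := @mean_value_dist R n psi
    (fun s => F (u x s) - F (u y s) - (x - y) *m A) T (w * `|x - y|) _ _ 0 t.
  rewrite (_ : psi 0 = x - y); last by rewrite /psi scale0r subr0 !u00.
  rewrite normr0 subr0 [`|t| * w]mulrC [w * `|t| * _]mulrAC.
  have -> : u x t - u y t - (x - y) - t *: ((x - y) *m A) = psi t - (x - y).
    by rewrite /psi addrAC.
  apply=> //; last exact: ltW.
    move=> s sT; apply: is_derive_sub; last exact: is_derive_lin.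
    by apply: is_derive_sub; exact/uder/TT.
  move=> s sT; rewrite (FE _ (stayr x s xr sT)) (FE _ (stayr y s yr sT)).
  have xyE : x - y = u x 0 - u y 0 by rewrite !u00.
  pose z := u x s - u y s.
  have zle : `|z| <= 2 * `|x - y|.
    exact: stab.
  have zd : `|z - (x - y)| <= 2 * K * T * `|x - y|.
    rewrite [in leLHS]xyE.
    apply: (@le_trans _ _ (K * (2 * `|x - y|) * `|s - 0|)); last first.
      rewrite subr0 [leRHS](_ : _ = K * (2 * `|x - y|) * T); last by ring.
      by rewrite ler_wpM2l// !mulr_ge0// ltW.
    apply: (@mean_value_dist R n (fun s => u x s - u y s)
      (fun s => F (u x s) - F (u y s)) T) => //.
    + by move=> q qT; apply: is_derive_sub; exact/uder/TT.
    + move=> q qT; apply: le_trans (lipF _ _) _; rewrite ler_wpM2l ?(ltW K0)//.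
      exact: stab.
    + by rewrite normr0 ltW.
  have := hr0 _ _ (le_trans (stayr x s xr sT) r1r0)
                  (le_trans (stayr y s yr sT) r1r0).
  rewrite -/z => h1.
  have h2 := mulmx_norm_le A (z - (x - y)).
  rewrite -[X in `|X|](_ : (f (u x s) - f (u y s) - z *m A) +
    (z - (x - y)) *m A = _); last by rewrite [(z - _) *m A]mulmxBl subrKA.
  apply: le_trans (ler_normD _ _) _.
  apply: (@le_trans _ _ (w1 * (2 * `|x - y|) + a * (2 * K * T * `|x - y|))).
    rewrite lerD//.
      by apply: le_trans h1 _; rewrite ler_wpM2l// ltW.
    by apply: le_trans h2 _; rewrite ler_wpM2l.
  rewrite [leLHS](_ : _ = (2 * w1 + 2 * (a * K) * T) * `|x - y|); last by ring.
  by rewrite ler_wpM2r//; lra.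
- move=> s t sT tT.
  have := @mean_value_dist R n (fun s => u x s - s *: f x0)
    (fun s => F (u x s) - f x0) T w _ _ s t.
  have -> : u x t - t *: f x0 - (u x s - s *: f x0) =
            u x t - u x s - (t - s) *: f x0.
    by apply/rowP => i; rewrite !mxE; ring.
  apply=> // q qT; apply: is_derive_sub; last exact: is_derive_lin.
  exact/uder/TT.
- move=> t tT; set y := u x t.
  (* uniqueness: the curve started at phi t x is the curve of x shifted by t *)
  have T0' : 0 <= T by exact: ltW.
  have KT' : K * T <= 2^-1 by apply: le_trans T1; rewrite ler_wpM2l ?ltW//; lra.
  have := @ode_stable R n F K T (u y) (fun s => u x (s + t)) lipF T0' (ltW K0) KT'.
  move=> /(_ _ _ (- t)); rewrite addNr add0r u00 subrr normr0 mulr0 normrN u00.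
  move=> h; apply/eqP; rewrite -subr_eq0 -normr_le0; apply: h => //.
    by move=> s sT; exact/uder/TT.
  move=> s sT.
  have st : `|s + t| <= 2 * T by rewrite (le_trans (ler_normD _ _))//; lra.
  apply: is_derive_rv => i.
  have h1 := is_derive_coord i (uder x _ st).
  have h2 : is_derive s (1 : R) (fun s : R => s + t) 1.
    by apply: is_derive_eq; rewrite addr0.
  have := @is_derive1_comp R (fun s => u x s 0 i) (fun s => s + t) s _ _ h1 h2.
  by rewrite mulr1.
Qed.

End flow.

(** * Approximate moves *)

Section moves.
Variables (R : realType) (n : nat).
Local Notation V := 'rV[R]_n.
Implicit Types (Rel : V -> V -> Prop).

(** The parameter of a move is a row vector of any length [k], so that a move
    along one vector ([k = 1]) and a move in all directions ([k = n]) are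
    instances of the same notion and composition needs no change of
    parameter space. *)
Definition approx_move Rel (e : R) (x0 : V) k (L : 'M[R]_(k, n)) : Prop :=
  exists (d : R) (m : 'rV[R]_k -> V -> V),
  [/\ 0 < d, m 0 x0 = x0,
      forall s x, `|s| <= d -> `|x - x0| <= d -> Rel x (m s x)
    & forall s s' x x', `|s| <= d -> `|s'| <= d ->
        `|x - x0| <= d -> `|x' - x0| <= d ->
        `|m s x - m s' x' - (x - x') - (s - s') *m L|
          <= e * (`|x - x'| + `|s - s'|)].

Definition movable Rel (x0 : V) k (L : 'M[R]_(k, n)) : Prop :=
  forall e : R, 0 < e -> approx_move Rel e x0 L.

Lemma approx_move_perturb Rel e e' x0 k (L L' : 'M[R]_(k, n)) :
  approx_move Rel e x0 L -> e + opnorm (L - L') <= e' ->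
  approx_move Rel e' x0 L'.
Proof.
move=> [d [m [d0 m0 mR mE]]] ee'; exists d, m; split=> // s s' x x' sd s'd xd x'd.
rewrite -[X in `|X|](_ : (m s x - m s' x' - (x - x') - (s - s') *m L) +
    (s - s') *m (L - L') = _); last by rewrite mulmxBr subrKA.
apply: le_trans (ler_normD _ _) _.
apply: (@le_trans _ _ ((e + opnorm (L - L')) * (`|x - x'| + `|s - s'|))).
  rewrite mulrDl lerD ?mE// (le_trans (mulmx_norm_le _ _))//.
  by rewrite ler_wpM2l ?opnorm_ge0// lerDr.
by rewrite ler_wpM2r// addr_ge0.
Qed.

Lemma opnorm0 k : opnorm (0 : 'M[R]_(k, n)) = 0.
Proof. by rewrite /opnorm big1// => i _; rewrite row0 normr0. Qed.

Lemma opnorm_rv (v : V) : opnorm v = `|v|.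
Proof. by rewrite /opnorm big_ord1 row_id. Qed.

Lemma approx_move_le Rel e e' x0 k (L : 'M[R]_(k, n)) :
  e <= e' -> approx_move Rel e x0 L -> approx_move Rel e' x0 L.
Proof.
by move=> ee' /approx_move_perturb; apply; rewrite subrr opnorm0 addr0.
Qed.

Lemma move_lip e k (L : 'M[R]_(k, n)) (p q x x' : V) (s s' : 'rV_k) :
  `|p - q - (x - x') - (s - s') *m L| <= e * (`|x - x'| + `|s - s'|) ->
  `|p - q| <= (1 + e) * `|x - x'| + (opnorm L + e) * `|s - s'|.
Proof.
move=> h; have h2 := mulmx_norm_le L (s - s').
rewrite -[p - q](subrK (x - x')) (le_trans (ler_normD _ _))//.
rewrite -[p - q - _](subrK ((s - s') *m L)).
rewrite (le_trans (lerD (ler_normD _ _) (lexx _)))//.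
rewrite (le_trans (lerD (lerD h h2) (lexx _)))//.
by rewrite mulrDr; lra.
Qed.

Lemma approx_move_add Rel e1 e2 x0 k (L1 L2 : 'M[R]_(k, n)) :
  (forall x y z, Rel x y -> Rel y z -> Rel x z) -> 0 <= e1 <= 1 -> 0 <= e2 ->
  approx_move Rel e1 x0 L1 -> approx_move Rel e2 x0 L2 ->
  approx_move Rel (e1 + e2 * (3 + opnorm L1)) x0 (L1 + L2).
Proof.
move=> Rtr /andP[e10 e11] e20 [d1 [m1 [d10 m10 mR1 mE1]]].
move=> [d2 [m2 [d20 m20 mR2 mE2]]].
have l0 := opnorm_ge0 L1; set l := opnorm L1 in l0 *.
have D0 : 0 < l + 3 by lra.
pose d := Num.min d1 (d2 / (l + 3)).
have d0 : 0 < d by rewrite /d lt_min d10 divr_gt0.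
have dd1 : d <= d1 by rewrite /d ge_min lexx.
have dd2' : (l + 3) * d <= d2.
  by rewrite mulrC -ler_pdivlMr// /d ge_min lexx orbT.
have dd2 : d <= d2 by have : 0 <= l * d by [rewrite mulr_ge0// ltW]; lra.
have lip s s' x x' : `|s| <= d -> `|s'| <= d -> `|x - x0| <= d ->
    `|x' - x0| <= d ->
    `|m1 s x - m1 s' x'| <= 2 * `|x - x'| + (l + 1) * `|s - s'|.
  move=> sd s'd xd x'd.
  apply: (le_trans (move_lip (mE1 s s' x x' _ _ _ _))); rewrite ?(le_trans _ dd1)//.
  by rewrite lerD// ler_wpM2r// /l; lra.
have near s x : `|s| <= d -> `|x - x0| <= d -> `|m1 s x - x0| <= d2.
  move=> sd xd; rewrite -[X in _ - X]m10.
  have := lip s 0 x x0 sd; rewrite subrr !normr0 subr0.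
  move=> /(_ (ltW d0) xd (ltW d0)) /le_trans; apply.
  apply: le_trans dd2'; rewrite (_ : (l + 3) * d = 2 * d + (l + 1) * d); last by ring.
  by rewrite lerD ?ler_wpM2l//; lra.
exists d, (fun s x => m2 s (m1 s x)); split=> //.
- by rewrite m10 m20.
- move=> s x sd xd; apply: (Rtr _ (m1 s x)).
    by apply: mR1; rewrite (le_trans _ dd1).
  by apply: mR2; [rewrite (le_trans _ dd2)|exact: near].
- move=> s s' x x' sd s'd xd x'd.
  have h1 := mE1 s s' x x' (le_trans sd dd1) (le_trans s'd dd1)
    (le_trans xd dd1) (le_trans x'd dd1).
  have h2 := mE2 s s' _ _ (le_trans sd dd2) (le_trans s'd dd2)
    (near s x sd xd) (near s' x' s'd x'd).
  have h3 := lip s s' x x' sd s'd xd x'd.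
  set p := m1 s x in h1 h2 h3 *; set q := m1 s' x' in h1 h2 h3 *.
  rewrite -[X in `|X|](_ : (m2 s p - m2 s' q - (p - q) - (s - s') *m L2) +
    (p - q - (x - x') - (s - s') *m L1) = _); last first.
    by rewrite mulmxDr; apply/rowP => i; rewrite !mxE; ring.
  apply: le_trans (ler_normD _ _) _; apply: le_trans (lerD h2 h1) _.
  rewrite addrC [leRHS]mulrDl lerD// -mulrA ler_wpM2l//.
  apply: (le_trans (lerD h3 (lexx _))).
  have := normr_ge0 (x - x'); have := normr_ge0 (s - s') => ? ?.
  have : 0 <= l * `|x - x'| by exact: mulr_ge0.
  by rewrite !mulrDl !mulrDr; lra.
Qed.

(** With [B] the 1 x 1 matrix [1 / tau] this is the change of time scale that
    turns an error [o(tau)] into [o(1)]. *)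
Lemma approx_move_reparam Rel e x0 k j (B : 'M[R]_(j, k)) (L : 'M[R]_(k, n)) :
  0 <= e ->
  approx_move Rel e x0 L -> approx_move Rel (e * (1 + opnorm B)) x0 (B *m L).
Proof.
move=> e0 [d [m [d0 m0 mR mE]]]; have b0 := opnorm_ge0 B.
have D0 : 0 < 1 + opnorm B by lra.
pose d' := d / (1 + opnorm B).
have d'0 : 0 < d' by rewrite divr_gt0.
have d'E : (1 + opnorm B) * d' = d by rewrite mulrC divfK// gt_eqF.
have d'd : d' <= d.
  by have : 0 <= opnorm B * d' by [rewrite mulr_ge0// ltW]; lra.
have sB (s : 'rV_j) : `|s| <= d' -> `|s *m B| <= d.
  move=> sd; apply: (le_trans (mulmx_norm_le _ _)).
  apply: (@le_trans _ _ (opnorm B * d')); first by rewrite ler_wpM2l.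
  lra.
exists d', (fun s x => m (s *m B) x); split=> //.
- by rewrite mul0mx.
- by move=> s x sd xd; apply: mR; [exact: sB|exact: le_trans d'd].
- move=> s s' x x' sd s'd xd x'd; rewrite mulmxA.
  have := mE _ _ _ _ (sB _ sd) (sB _ s'd) (le_trans xd d'd) (le_trans x'd d'd).
  rewrite -mulmxBl => /le_trans; apply; rewrite -mulrA ler_wpM2l//.
  rewrite mulrDr lerD//.
    by rewrite ler_peMl//; lra.
  apply: (le_trans (mulmx_norm_le _ _)).
  by rewrite ler_wpM2r//; lra.
Qed.

(** Collects the error terms of [approx_move_conj]. *)
Lemma conj_error_le (b l e eta X S : R) : 1 <= b -> 0 <= l -> 0 <= e ->
  0 <= eta -> 0 <= X -> 0 <= S ->
  eta * (2 * (b + 1) * X + (l + 1) * S) +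
    (e * (b * (b + 1) * X + b * S) + (eta * (b * X) + eta * X)) <=
  (4 * (b + 1) ^+ 2 + l) * (eta + e) * (X + S).
Proof.
move=> b1 l0 e0 eta0 X0 S0; set c := 4 * (b + 1) ^+ 2 + l.
have b2 : b <= b * b by rewrite ler_peMr//; lra.
have mulX u : u <= c -> u * X <= c * X by move=> h; rewrite ler_wpM2r.
have mulS u : u <= c -> u * S <= c * S by move=> h; rewrite ler_wpM2r.
have k1 : (3 * b + 3) * X <= c * X by apply: mulX; rewrite /c expr2; lra.
have k2 : (l + 1) * S <= c * S by apply: mulS; rewrite /c expr2; lra.
have k3 : b * (b + 1) * X <= c * X by apply: mulX; rewrite /c expr2; lra.
have k4 : b * S <= c * S by apply: mulS; rewrite /c expr2; lra.
have t1 := ler_wpM2l eta0 (lerD k1 k2); have t2 := ler_wpM2l e0 (lerD k3 k4).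
rewrite [leLHS](_ : _ = eta * ((3 * b + 3) * X + (l + 1) * S) +
  e * (b * (b + 1) * X + b * S)); last by ring.
rewrite [leRHS](_ : _ = eta * (c * X + c * S) + e * (c * X + c * S)); last by ring.
exact: lerD.
Qed.

(** Used twice: with [psi] and [psi'] the flow of a field at times [- tau] and
    [tau], and with the coordinate changes between two charts.  In the first
    case [eta] is a small multiple of [tau] and [B' *m B] differs from the
    identity by a term of order [tau ^ 2]. *)
Lemma approx_move_conj Rel Rel' (psi psi' : V -> V) (x0 y0 : V)
    (B B' : 'M[R]_n) k (L : 'M[R]_(k, n)) (e eta rho b l : R) :
  0 < rho -> 0 <= e <= 1 -> 0 <= eta <= 1 -> 1 <= b -> 0 <= l ->
  psi' x0 = y0 -> psi y0 = x0 ->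
  (forall y z, `|y - y0| <= rho -> `|z - y0| <= rho ->
     `|psi y - psi z - (y - z) *m B| <= eta * `|y - z|) ->
  (forall y z, `|y - x0| <= rho -> `|z - x0| <= rho ->
     `|psi' y - psi' z - (y - z) *m B'| <= eta * `|y - z|) ->
  (forall z : V, `|z *m (B' *m B - 1%:M)| <= eta * `|z|) ->
  (forall z : V, `|z *m B| <= b * `|z|) ->
  (forall z : V, `|z *m B'| <= b * `|z|) ->
  (forall s : 'rV_k, `|s *m L| <= l * `|s|) ->
  (forall x y, `|x - x0| <= rho -> `|y - y0| <= rho ->
     Rel (psi' x) y -> Rel' x (psi y)) ->
  approx_move Rel e y0 L ->
  approx_move Rel' ((4 * (b + 1) ^+ 2 + l) * (eta + e)) x0 (L *m B).
Proof.
move=> rho0 /andP[e0 e1] /andP[eta0 eta1] b1 l0 psi'0 psi0 hpsi hpsi' hBB hB hB' hL.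
move=> hR [d [m [d0 m0 mR mE]]].
have b0 : 0 <= b by exact: le_trans ler01 b1.
(* c bounds the Lipschitz constant of (s, x) |-> m s (psi' x) *)
pose c := 2 * (b + 1) + l + 1.
have c1 : 1 <= c by rewrite /c; lra.
have c0 : 0 < c by lra.
pose d' := Num.min rho d / c.
have dm0 : 0 < Num.min rho d by rewrite lt_min rho0.
have d'0 : 0 < d' by rewrite divr_gt0.
have cd' : c * d' = Num.min rho d by rewrite mulrC divfK// gt_eqF.
have d'm : d' <= Num.min rho d.
  by rewrite -cd' ler_peMl// ltW.
have d'rho : d' <= rho by apply: le_trans d'm _; rewrite ge_min lexx.
have d'd : d' <= d by apply: le_trans d'm _; rewrite ge_min lexx orbT.
have lip' x x' : `|x - x0| <= d' -> `|x' - x0| <= d' ->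
    `|psi' x - psi' x'| <= (b + 1) * `|x - x'|.
  move=> xd x'd; have := hpsi' _ _ (le_trans xd d'rho) (le_trans x'd d'rho) => h.
  rewrite -[psi' x - psi' x'](subrK ((x - x') *m B')) (le_trans (ler_normD _ _))//.
  rewrite mulrDl addrC lerD// ?hB'//; apply: le_trans h _.
  by rewrite ler_wpM2r.
have x0d : `|x0 - x0| <= d' by rewrite subrr normr0 ltW.
have psid x : `|x - x0| <= d' -> `|psi' x - y0| <= (b + 1) * d'.
  move=> xd; rewrite -psi'0; apply: le_trans (lip' _ _ xd x0d) _.
  by rewrite ler_wpM2l//; lra.
have bd : (b + 1) * d' <= d.
  apply: (@le_trans _ _ (c * d')); last by rewrite cd' ge_min lexx orbT.
  by rewrite ler_wpM2r ?(ltW d'0)// /c; lra.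
have mlip s s' y y' : `|s| <= d' -> `|s'| <= d' -> `|y - y0| <= d -> `|y' - y0| <= d ->
    `|m s y - m s' y'| <= 2 * `|y - y'| + (l + 1) * `|s - s'|.
  move=> sd s'd yd y'd.
  have h := mE _ _ _ _ (le_trans sd d'd) (le_trans s'd d'd) yd y'd.
  rewrite -[m s y - m s' y'](subrK (y - y')) (le_trans (ler_normD _ _))//.
  rewrite -[m s y - m s' y' - _](subrK ((s - s') *m L)).
  rewrite (le_trans (lerD (ler_normD _ _) (lexx _)))//.
  rewrite (le_trans (lerD (lerD h (hL _)) (lexx _)))//.
  have : e * (`|y - y'| + `|s - s'|) <= `|y - y'| + `|s - s'|.
    by rewrite ler_piMl// addr_ge0.
  by rewrite mulrDl; lra.
have mrho s x : `|s| <= d' -> `|x - x0| <= d' -> `|m s (psi' x) - y0| <= rho.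
  move=> sd xd; rewrite -[X in _ - X]m0.
  have y0d : `|y0 - y0| <= d by rewrite subrr normr0 ltW.
  have z0 : `|0 : 'rV[R]_k| <= d' by rewrite normr0 ltW.
  have := mlip s 0 (psi' x) y0 sd z0 (le_trans (psid _ xd) bd) y0d.
  rewrite subr0 => /le_trans; apply.
  apply: (@le_trans _ _ (c * d')); last by rewrite cd' ge_min lexx.
  have := psid _ xd => h.
  have : (l + 1) * `|s| <= (l + 1) * d' by rewrite ler_wpM2l//; lra.
  by rewrite /c; move: h; rewrite !mulrDl -!mulrA !mulrDl; lra.
exists d', (fun s x => psi (m s (psi' x))); split=> //.
- by rewrite psi'0 m0.
- move=> s x sd xd; apply: hR; first exact: le_trans d'rho.
    exact: mrho.
  by apply: mR; [exact: le_trans d'd|exact: le_trans (psid _ xd) bd].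
move=> s s' x x' sd s'd xd x'd.
set y := psi' x; set y' := psi' x'.
have yd : `|y - y0| <= d by exact: le_trans (psid _ xd) bd.
have y'd : `|y' - y0| <= d by exact: le_trans (psid _ x'd) bd.
have h1 := hpsi _ _ (mrho s x sd xd) (mrho s' x' s'd x'd).
have h2 := mE _ _ _ _ (le_trans sd d'd) (le_trans s'd d'd) yd y'd.
have h3 := hpsi' _ _ (le_trans xd d'rho) (le_trans x'd d'rho).
have h4 := hBB (x - x').
have h5 := mlip _ _ _ _ sd s'd yd y'd.
have h6 := lip' _ _ xd x'd.
rewrite -/y -/y' in h1 h3 h6.
set p := m s y in h1 h2 h5 *; set q := m s' y' in h1 h2 h5 *.
set X := `|x - x'| in h3 h4 h6 *; set S := `|s - s'| in h2 h5 *.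
have X0 : 0 <= X by exact: normr_ge0.
have S0 : 0 <= S by exact: normr_ge0.
rewrite -[X in `|X|](_ : (psi p - psi q - (p - q) *m B) +
   ((p - q - (y - y') - (s - s') *m L) *m B +
    ((y - y' - (x - x') *m B') *m B +
     (x - x') *m (B' *m B - 1%:M))) = _); last first.
  rewrite !(mulmxBl, mulmxBr) !mulmxA !mulmx1.
  by apply/rowP => i; rewrite !mxE; ring.
rewrite (le_trans (ler_normD _ _))//.
rewrite (le_trans (lerD (lexx _) (ler_normD _ _)))//.
rewrite (le_trans (lerD (lexx _) (lerD (lexx _) (ler_normD _ _))))//.
have g1 : `|psi p - psi q - (p - q) *m B| <=
    eta * (2 * (b + 1) * X + (l + 1) * S).
  apply: le_trans h1 _; rewrite ler_wpM2l//; apply: le_trans h5 _.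
  by rewrite lerD// -mulrA ler_wpM2l.
have g2 : `|(p - q - (y - y') - (s - s') *m L) *m B| <=
    e * (b * (b + 1) * X + b * S).
  apply: le_trans (hB _) _.
  apply: (@le_trans _ _ (b * (e * ((b + 1) * X + S)))).
    rewrite ler_wpM2l//.
    by apply: le_trans h2 _; rewrite ler_wpM2l// lerD.
  by rewrite mulrCA ler_wpM2l// mulrDr mulrA.
have g3 : `|(y - y' - (x - x') *m B') *m B| <= eta * (b * X).
  by apply: le_trans (hB _) _; rewrite mulrCA ler_wpM2l.
apply: le_trans (lerD g1 (lerD g2 (lerD g3 h4))) _.
exact: conj_error_le.
Qed.

(** The iteration [s |-> s - (m s x0 - y)] halves the error at each step, since
    [s |-> m s x0] differs from a translation by a map of Lipschitz constant
    [1 / 2]. *)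
Lemma approx_move_open Rel x0 : approx_move Rel 2^-1 x0 (1%:M : 'M[R]_n) ->
  exists2 r, 0 < r & forall y, `|y - x0| <= r -> Rel x0 y.
Proof.
move=> [d [m [d0 m0 mR mE]]].
have x00 : `|x0 - x0| <= d by rewrite subrr normr0 ltW.
pose F s := m s x0.
have hF s s' : `|s| <= d -> `|s'| <= d ->
    `|F s - F s' - (s - s')| <= 2^-1 * `|s - s'|.
  move=> sd s'd; have := mE s s' x0 x0 sd s'd x00 x00.
  by rewrite subrr normr0 add0r subr0 mulmx1.
exists (d / 2) => [|y yd]; first by rewrite divr_gt0.
pose C := `|y - x0|; have C0 : 0 <= C by exact: normr_ge0.
have Cd : 2 * C <= d by rewrite /C; lra.
pose s k := iter k (fun s => s - (F s - y)) 0.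
have sS k : s k.+1 - s k = - (F (s k) - y) by rewrite /s/= addrAC subrr add0r.
have key k : `|F (s k) - y| <= C / 2 ^+ k /\ `|s k| <= 2 * C - 2 * C / 2 ^+ k.
  elim: k => [|k [IH1 IH2]].
    by rewrite expr0 !divr1 /s/= /F m0 normr0 subrr distrC.
  have p0 : 0 <= 2 * C / 2 ^+ k by rewrite divr_ge0 ?mulr_ge0 ?exprn_ge0.
  have E : 2 * C / 2 ^+ k.+1 = C / 2 ^+ k.
    by rewrite exprS invfM mulrACA divff// mul1r.
  have p1 : 0 <= 2 * C / 2 ^+ k.+1 by rewrite divr_ge0 ?mulr_ge0 ?exprn_ge0.
  have s1 : `|s k.+1| <= 2 * C - 2 * C / 2 ^+ k.+1.
    rewrite -(subrK (s k) (s k.+1)) (le_trans (ler_normD _ _))// sS normrN.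
    by move: IH1 IH2 p1; rewrite E -mulrA; lra.
  split=> //.
  have := hF (s k.+1) (s k).
  rewrite sS opprK normrN addrA subrK => /(_ _ _) h.
  apply: le_trans (h _ _) _.
  - lra.
  - lra.
  - by rewrite exprS invfM mulrCA ler_wpM2l//; lra.
have incr k : `|s k.+1 - s k| <= C / 2 ^+ k by rewrite sS normrN; case: (key k).
have [l [_ hl]] := geometric_increments_cvg incr.
have ld : `|l| <= d.
  have := hl 0%N; rewrite /s/= subr0 expr0 divr1 => /le_trans; apply.
  by rewrite /C; lra.
have sd k : `|s k| <= d.
  have [_ ] := key k; have : 0 <= 2 * C / 2 ^+ k.
    by rewrite divr_ge0 ?mulr_ge0 ?exprn_ge0.
  by rewrite /C in yd *; lra.
suff -> : y = F l by apply: mR.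
apply/esym/eqP; rewrite -subr_eq0 -normr_le0.
apply/ler_addgt0Pr => e e0; rewrite add0r.
have [k hk] : exists k, 4 * C / 2 ^+ k <= e.
  have := @cvg_geometric R (4 * C) 2^-1.
  rewrite ger0_norm ?invr_ge0// invf_lt1// ltr1n => /(_ erefl).
  move/cvgrPdist_le => /(_ _ e0)[k _ /(_ k (leqnn _))].
  rewrite /= sub0r normrN => /(le_trans (ler_norm _)).
  by rewrite /geometric/= exprVn; exists k.
have [h1 _] := key k; have h2 := hl k; have h3 := hF _ _ ld (sd k).
rewrite -(subrKA (F (s k))) (le_trans (ler_normD _ _))//.
have : `|F l - F (s k)| <= 3 / 2 * `|l - s k|.
  rewrite -[F l - _](subrK (l - s k)) (le_trans (ler_normD _ _))//.
  by lra.
by move: h1 h2 hk; rewrite -!mulrA; lra.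
Qed.

End moves.

(** * Movable directions *)

Section movable.
Variables (R : realType) (n : nat).
Local Notation V := 'rV[R]_n.
Variable Rel : V -> V -> Prop.
Hypothesis Rel_refl : forall x, Rel x x.
Hypothesis Rel_trans : forall x y z, Rel x y -> Rel y z -> Rel x z.

Lemma movable0 (x0 : V) k : movable Rel x0 (0 : 'M[R]_(k, n)).
Proof.
move=> e e0; exists 1, (fun _ x => x); split=> // s s' x x' _ _ _ _.
by rewrite mulmx0 subr0 subrr normr0 mulr_ge0 ?addr_ge0// ltW.
Qed.

Lemma movableD (x0 : V) k (L1 L2 : 'M[R]_(k, n)) :
  movable Rel x0 L1 -> movable Rel x0 L2 -> movable Rel x0 (L1 + L2).
Proof.
move=> h1 h2 e e0; have l0 := opnorm_ge0 L1.
have D0 : 0 < 3 + opnorm L1 by lra.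
pose e1 := Num.min 1 (e / 2); pose e2 := e / 2 / (3 + opnorm L1).
have e10 : 0 < e1 by rewrite /e1 lt_min ltr01/= divr_gt0.
have e11 : 0 <= e1 <= 1 by rewrite ltW//= /e1 ge_min lexx.
have e20 : 0 < e2 by rewrite !divr_gt0.
apply: approx_move_le (approx_move_add Rel_trans e11 (ltW e20) (h1 _ e10) (h2 _ e20)).
rewrite /e2 divfK ?gt_eqF//.
have : e1 <= e / 2 by rewrite /e1 ge_min lexx orbT.
lra.
Qed.

Lemma movable_mul (x0 : V) k j (B : 'M[R]_(j, k)) (L : 'M[R]_(k, n)) :
  movable Rel x0 L -> movable Rel x0 (B *m L).
Proof.
move=> h e e0; have b0 := opnorm_ge0 B.
have D0 : 0 < 1 + opnorm B by lra.
have e10 : 0 < e / (1 + opnorm B) by rewrite divr_gt0.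
apply: approx_move_le (approx_move_reparam B (ltW e10) (h _ e10)).
by rewrite divfK// gt_eqF.
Qed.

Lemma movableZ (x0 : V) (c : R) (v : V) :
  movable Rel x0 v -> movable Rel x0 (c *: v).
Proof. by rewrite -mul_scalar_mx; exact: movable_mul. Qed.

Lemma movable_sum (x0 : V) k (I : Type) (r : seq I) (P : pred I)
    (F : I -> 'M[R]_(k, n)) :
  (forall i, P i -> movable Rel x0 (F i)) ->
  movable Rel x0 (\sum_(i <- r | P i) F i).
Proof.
by move=> h; apply: big_ind => //; [exact: movable0|exact: movableD].
Qed.

(** All directions together: the parameter of the move then ranges over a
    neighbourhood of 0 in the whole space. *)
Lemma movable_open (x0 : V) : (forall v : V, movable Rel x0 v) ->
  exists2 r, 0 < r & forall y, `|y - x0| <= r -> Rel x0 y.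
Proof.
move=> h; apply: approx_move_open.
suff : movable Rel x0 (1%:M : 'M[R]_n) by apply; rewrite invr_gt0.
rewrite mx1_sum_delta; apply: movable_sum => i _.
by rewrite -(mul_delta_mx (0 : 'I_1)); exact: movable_mul.
Qed.

Definition flow_reachable (f : V -> V) (x0 : V) : Prop :=
  exists2 rho, 0 < rho & forall (u : R -> V) (T : R),
    (forall t, `|t| <= T ->
       is_derive t (1 : R) u (f (u t)) /\ `|u t - x0| <= rho) ->
    forall t, `|t| <= T -> Rel (u 0) (u t).

Lemma rv1_norm (s : 'rV[R]_1) : `|s| = `|s 0 0|.
Proof.
apply/eqP; rewrite eq_le rv_coord_le andbT.
by apply: rv_norm_le => // i; rewrite ord1.
Qed.

Lemma mul_rv1 (s : 'rV[R]_1) (v : V) : s *m v = s 0 0 *: v.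
Proof. by rewrite [s]mx11_scalar mul_scalar_mx mxE eqxx. Qed.

Lemma movable_flow (f : V -> V) (x0 : V) (A : 'M[R]_n) :
  strictly_diff f x0 A -> flow_reachable f x0 -> movable Rel x0 (f x0).
Proof.
move=> df [rho rho0 hrho] e e0; pose a := opnorm A.
have a0 : 0 <= a := opnorm_ge0 A.
pose w := Num.min 1 (e / 2).
have w0 : 0 < w by rewrite /w lt_min ltr01 divr_gt0.
have w1 : w <= 1 by rewrite /w ge_min lexx.
have w2 : w <= e / 2 by rewrite /w ge_min lexx orbT.
have [r [T [phi [r0 T0 hphi]]]] := local_flow df w0 rho0.
pose d := Num.min (Num.min r T) (Num.min 1 (e / 2 / (1 + a))).
have D0 : 0 < 1 + a by lra.
have d0 : 0 < d by rewrite /d !lt_min r0 T0 ltr01 !divr_gt0.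
have dr : d <= r by rewrite /d !ge_min lexx.
have dT : d <= T by rewrite /d !ge_min lexx orbT.
have da : d * (1 + a) <= e / 2.
  by rewrite -ler_pdivlMr// /d !ge_min lexx !orbT.
exists d, (fun s x => phi (s 0 0) x); split=> //.
- rewrite mxE; have [|-> //] := hphi x0.
  by rewrite subrr normr0 ltW.
- move=> s x sd xd; have [p0 p1 _ _ _] := hphi x (le_trans xd dr).
  rewrite -{1}p0; apply: (hrho (phi^~ x) T) => //.
  by rewrite -rv1_norm (le_trans sd).
- move=> s s' x x' sd s'd xd x'd.
  have [_ _ p2 _ _] := hphi x (le_trans xd dr).
  have [_ _ _ p3 _] := hphi x' (le_trans x'd dr).
  have sT : `|s 0 0| <= T by rewrite -rv1_norm (le_trans sd).
  have s'T : `|s' 0 0| <= T by rewrite -rv1_norm (le_trans s'd).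
  have {p2} := p2 (s 0 0) x' sT (le_trans x'd dr) => h2.
  have {p3} := p3 (s' 0 0) (s 0 0) s'T sT => h3.
  have h4 : `|s 0 0 *: ((x - x') *m A)| <= d * a * `|x - x'|.
    rewrite normrZ -mulrA ler_pM// ?mulmx_norm_le//.
    by rewrite -rv1_norm.
  have -> : `|s - s'| = `|s 0 0 - s' 0 0| by rewrite rv1_norm !mxE.
  rewrite mul_rv1 !mxE.
  set t := s 0 0 in h2 h3 h4 sT *; set t' := s' 0 0 in h3 *.
  rewrite -[X in `|X|](_ : (phi t x - phi t x' - (x - x') - t *: ((x - x') *m A))
    + (t *: ((x - x') *m A) + (phi t x' - phi t' x' - (t - t') *: f x0)) = _);
    last by apply/rowP => i; rewrite !mxE; ring.
  rewrite (le_trans (ler_normD _ _))//.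
  rewrite (le_trans (lerD h2 (le_trans (ler_normD _ _) (lerD h4 h3))))//.
  have td : `|t| <= d by rewrite /t -rv1_norm.
  have X0 := normr_ge0 (x - x').
  have k1 : `|t| * w * `|x - x'| <= d * `|x - x'|.
    by rewrite ler_wpM2r// -[leRHS]mulr1 ler_pM// ltW.
  have k2 : d * (1 + a) * `|x - x'| <= e / 2 * `|x - x'| by rewrite ler_wpM2r.
  have k3 : w * `|t - t'| <= e / 2 * `|t - t'| by rewrite ler_wpM2r.
  have k4 : 0 <= e / 2 * `|x - x'| by rewrite mulr_ge0// divr_ge0// ltW.
  have k5 : 0 <= e / 2 * `|t - t'| by rewrite mulr_ge0// divr_ge0// ltW.
  move: k1 k2 k3 k4 k5; rewrite !(mulrDr, mulrDl) mulr1; lra.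
Qed.

End movable.

(** * Brackets of movable fields *)

Section bracket.
Variables (R : realType) (n : nat).
Local Notation V := 'rV[R]_n.
Variable Rel : V -> V -> Prop.
Hypothesis Rel_trans : forall x y z, Rel x y -> Rel y z -> Rel x z.

Lemma dist_half_le (r rr : R) (u y x : V) : rr <= r / 2 ->
  `|u - y| <= rr -> `|y - x| <= rr -> `|u - x| <= r.
Proof.
move=> h1 h2 h3; rewrite -(subrKA y) (le_trans (ler_normD _ _))//; lra.
Qed.

Lemma bracket_error_le (b c C2 eta x : R) : 0 <= eta ->
  x <= eta * (c + 1) + (eta * b + eta) ->
  C2 * eta + x <= (C2 + (c + 1) + b + 1) * eta.
Proof. by move=> ? /le_trans h; rewrite !mulrDl mul1r; apply: (le_trans (lerD (lexx _) (h _ (lexx _)))); lra. Qed.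

(** With [m] a move along [g (phi tau x0)] at [phi tau x0] and [m'] a move
    along [g x0] at [x0], the map [phi (- tau) (m s (phi tau (m' (- s) x)))]
    moves [x] by [s] times
      [g (phi tau x0) *m (1 - tau A) - g x0 = tau (f x0 *m B - g x0 *m A) + o(tau)].
    All errors are multiples of [eta = tau * w], where [w] is as small as desired. *)
Lemma movable_bracket (f g : V -> V) (x0 : V) (A B : 'M[R]_n) (rho : R) :
  0 < rho -> strictly_diff f x0 A -> flow_reachable Rel f x0 ->
  (forall w : R, 0 < w -> exists2 r : R, 0 < r & forall x, `|x - x0| <= r ->
     `|g x - g x0 - (x - x0) *m B| <= w * `|x - x0|) ->
  (forall x, `|x - x0| <= rho -> movable Rel x (g x)) ->
  movable Rel x0 (f x0 *m B - g x0 *m A).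
Proof.
move=> rho0 df [rf rf0 hrf] dg mg e e0.
pose a := opnorm A; have a0 : 0 <= a := opnorm_ge0 A.
pose b := opnorm B; have b0 : 0 <= b := opnorm_ge0 B.
pose c := `|f x0|; have c0 : 0 <= c := normr_ge0 _.
pose G := `|g x0|; have G0 : 0 <= G := normr_ge0 _.
pose C1 := 2 * (4 * (a + 1 + 1) ^+ 2 + (G + 1)).
have C10 : 0 <= C1 by rewrite /C1 mulr_ge0// addr_ge0// ?mulr_ge0 ?sqr_ge0//; lra.
pose C2 := 1 + C1 * (3 + G).
have C20 : 0 <= C2 by rewrite /C2 addr_ge0// mulr_ge0//; lra.
pose C3 := C2 + (c + 1) + b + 1.
have C30 : 0 < C3 by rewrite /C3; lra.
pose w := Num.min 1 (e / (2 * C3)).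
have w0 : 0 < w by rewrite /w lt_min ltr01 divr_gt0// mulr_gt0.
have w1 : w <= 1 by rewrite /w ge_min lexx.
have wC3 : 2 * C3 * w <= e.
  by rewrite mulrC -ler_pdivlMr ?mulr_gt0// /w ge_min lexx orbT.
have [r [T [phi [r0 T0 hphi]]]] := local_flow df w0 rf0.
have [r1 r10 hr1] := dg _ w0.
pose rr := Num.min (r / 2) (Num.min rho r1).
have rr0 : 0 < rr by rewrite /rr !lt_min divr_gt0// rho0.
have rrr : rr <= r / 2 by rewrite /rr ge_min lexx.
have rr_r : rr <= r by apply: le_trans rrr _; rewrite ler_pdivrMr// ler_peMr ?ler1n ?ltW.
have rrrho : rr <= rho by rewrite /rr !ge_min lexx orbT.
have rrr1 : rr <= r1 by rewrite /rr !ge_min lexx !orbT.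
(* the conjugation time: small enough for all quadratic remainders *)
pose q := a * a + a * (1 + b) * (c + 1) + 1.
have aa0 : 0 <= a * a by exact: mulr_ge0.
have abc0 : 0 <= a * (1 + b) * (c + 1) by rewrite !mulr_ge0 ?addr_ge0.
have q0 : 0 < q by rewrite /q ltr_wpDl ?addr_ge0.
have D0 : 0 < (c + 1) * (1 + b) 
  by apply: mulr_gt0; [rewrite ltr_wpDl|rewrite ltr_pwDl].
pose tau := Num.min (Num.min 1 T) (Num.min (w / q) (Num.min 1 rr / ((c + 1) * (1 + b)))).
have tau0 : 0 < tau by rewrite /tau !lt_min ltr01 T0 !divr_gt0// lt_min ltr01.
have tau1 : tau <= 1 by rewrite /tau !ge_min lexx.
have tauT : tau <= T by rewrite /tau !ge_min lexx orbT.
have tauq : tau * q <= w by rewrite -ler_pdivlMr// /tau !ge_min lexx !orbT.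
have taur : tau * ((c + 1) * (1 + b)) <= Num.min 1 rr.
  by rewrite -ler_pdivlMr// /tau !ge_min lexx !orbT.
have nT : `|tau| <= T by rewrite gtr0_norm.
have nT' : `|- tau| <= T by rewrite normrN.
have x0r : `|x0 - x0| <= r by rewrite subrr normr0 ltW.
pose y0 := phi tau x0.
have [p00 _ _ p03 p04] := hphi x0 x0r.
have y0E : `|y0 - x0 - tau *: f x0| <= w * tau.
  have := p03 0 tau; rewrite normr0 p00 subr0 gtr0_norm//.
  by apply=> //; exact: ltW.
have y0c : `|y0 - x0| <= tau * (c + 1).
  rewrite -[y0 - x0](subrK (tau *: f x0)) (le_trans (ler_normD _ _))//.
  rewrite normrZ gtr0_norm// mulrDr mulr1 addrC lerD//.
  by apply: le_trans y0E _; rewrite ler_piMl// ltW.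
have tc1 : tau * (c + 1) <= Num.min 1 rr.
  have tc0 : 0 <= tau * (c + 1) by rewrite mulr_ge0 ?(ltW tau0) ?addr_ge0.
  by apply: le_trans taur; rewrite mulrA ler_peMr ?lerDl.
have y0rr : `|y0 - x0| <= rr.
  by apply: le_trans y0c (le_trans tc1 _); rewrite ge_min lexx orbT.
have gy0 : `|g y0 - g x0| <= (1 + b) * (c + 1) * tau.
  have h := hr1 _ (le_trans y0rr rrr1).
  have h2 := mulmx_norm_le B (y0 - x0).
  rewrite -[g y0 - g x0](subrK ((y0 - x0) *m B)) (le_trans (ler_normD _ _))//.
  apply: (@le_trans _ _ ((1 + b) * `|y0 - x0|)).
    by rewrite mulrDl lerD//; apply: le_trans h _; rewrite ler_wpM2r.
  by rewrite -mulrA ler_wpM2l ?[_ * tau]mulrC ?addr_ge0.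
have gy1 : `|g y0| <= G + 1.
  rewrite -[g y0](subrK (g x0)) (le_trans (ler_normD _ _))// addrC lerD//.
  apply: le_trans gy0 _; rewrite mulrC [(1 + b) * _]mulrC.
  by apply: le_trans taur _; rewrite ge_min lexx.
pose eta := tau * w.
have eta0 : 0 < eta by exact: mulr_gt0.
have eta1 : eta <= 1 by rewrite /eta -[leRHS]mulr1 ler_pM// ltW.
have small (A' : 'M[R]_n) (z : V) : A' = tau *: A \/ A' = - (tau *: A) ->
    `|z *m (1%:M + A')| <= (a + 1) * `|z|.
  have h : `|z *m (tau *: A)| <= a * `|z|.
    rewrite -scalemxAr normrZ gtr0_norm//.
    apply: (le_trans _ (mulmx_norm_le A z)); rewrite ler_piMl//.
  move=> AE; rewrite mulmxDr mulmx1 (le_trans (ler_normD _ _))//.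
  by case: AE => ->; rewrite ?mulmxN ?normrN mulrDl mul1r addrC lerD.
(* the move in the direction g y0 at y0, conjugated back to x0 *)
have conj : approx_move Rel (C1 * eta) x0 (g y0 *m (1%:M + - (tau *: A))).
  have m0 := mg y0 (le_trans y0rr rrrho) _ eta0.
  have := @approx_move_conj R n Rel Rel (phi (- tau)) (phi tau) x0 y0
    (1%:M + - (tau *: A)) (1%:M + tau *: A) 1 (g y0) eta eta rr (a + 1) (G + 1).
  rewrite [X in approx_move Rel X x0](_ : _ = C1 * eta); last by rewrite /C1; ring.
  apply => //.
  - by rewrite (ltW eta0).
  - by rewrite (ltW eta0).
  - by rewrite lerDr.
  - by rewrite addr_ge0.
  - exact: p04.
  - move=> y z yr zr.
    have near u : `|u - y0| <= rr -> `|u - x0| <= r.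
      by move=> ur; exact: dist_half_le y0rr.
    have [_ _ p2 _ _] := hphi y (near _ yr).
    have := p2 _ z nT' (near _ zr); rewrite normrN gtr0_norm// -addrA -opprD.
    by rewrite mulmxDr mulmx1 mulmxN -scalemxAr -scaleNr.
  - move=> y z yr zr.
    have near u : `|u - x0| <= rr -> `|u - x0| <= r 
      by move=> ur; apply: le_trans ur rr_r.
    have [_ _ p2 _ _] := hphi y (near _ yr).
    have := p2 _ z nT (near _ zr); rewrite gtr0_norm// -addrA -opprD.
    by rewrite mulmxDr mulmx1 -scalemxAr.
  - move=> z.
    have -> : z *m ((1%:M + tau *: A) *m (1%:M + - (tau *: A)) - 1%:M) =
        - ((tau * tau) *: (z *m A *m A)).
      have -> : (1%:M + tau *: A) *m (1%:M + - (tau *: A)) - 1%:M =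
          - (tau *: A *m (tau *: A)).
        rewrite mulmxDl mul1mx mulmxDr mulmx1 mulmxN.
        by rewrite addrA subrK addrAC subrr add0r.
      by rewrite mulmxN -scalemxAl -!scalemxAr scalerA mulmxA.
    rewrite normrN normrZ gtr0_norm ?mulr_gt0//.
    apply: (@le_trans _ _ (tau * tau * (a * (a * `|z|)))).
      rewrite ler_wpM2l ?mulr_ge0 ?(ltW tau0)//.
      apply: (le_trans (mulmx_norm_le _ _)); rewrite ler_wpM2l//.
      exact: mulmx_norm_le.
    rewrite [a * _]mulrA mulrA ler_wpM2r// -mulrA /eta ler_wpM2l ?(ltW tau0)//.
    apply: le_trans tauq; rewrite ler_wpM2l ?(ltW tau0)// /q -addrA lerDl.
    by rewrite addr_ge0.
  - by move=> z; apply: small; right.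
  - by move=> z; apply: small; left.
  - by move=> s; rewrite (le_trans (mulmx_norm_le _ _))// opnorm_rv ler_wpM2r.
  - move=> x y xr yr Rxy.
    have near : `|y - x0| <= r.
      exact: dist_half_le y0rr.
    have nearx : `|x - x0| <= r by exact: le_trans rr_r.
    have [q0' q1 _ _ _] := hphi x nearx.
    have [s0 s1 _ _ _] := hphi y near.
    apply: (Rel_trans (y := phi tau x)).
      by rewrite -{1}q0'; exact: (hrf (phi^~ x) T q1 _ nT).
    apply: (Rel_trans Rxy).
    by rewrite -{1}s0; exact: (hrf (phi^~ y) T s1 _ nT').
have neg : approx_move Rel eta x0 (- g x0).
  rewrite -scaleN1r; apply: movableZ => //.
  by apply: mg; rewrite subrr normr0 ltW.
have eta01 : 0 <= eta <= 1 by rewrite (ltW eta0).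
have := approx_move_add Rel_trans eta01 (mulr_ge0 C10 (ltW eta0)) neg conj.
rewrite opnorm_rv normrN -/G.
rewrite (_ : eta + C1 * eta * (3 + G) = C2 * eta); last by rewrite /C2; ring.
move=> comp.
pose Z := f x0 *m B - g x0 *m A.
have scaled : approx_move Rel (C3 * eta) x0 (tau *: Z).
  apply: (approx_move_perturb comp); rewrite opnorm_rv.
  rewrite [X in `|X|](_ : _ = (g y0 - g x0 - (y0 - x0) *m B) +
    ((y0 - x0 - tau *: f x0) *m B - tau *: ((g y0 - g x0) *m A))); last first.
    rewrite /Z scalerBr !(mulmxDr, mulmxDl, mulmxN, mulNmx) mulmx1.
    rewrite -!scalemxAr -!scalemxAl.
    by apply/rowP => i; rewrite !mxE; ring.
  have k1 : `|g y0 - g x0 - (y0 - x0) *m B| <= eta * (c + 1).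
    apply: le_trans (hr1 _ (le_trans y0rr rrr1)) _.
    by rewrite /eta mulrAC mulrC ler_wpM2r// ltW.
  have k2 : `|(y0 - x0 - tau *: f x0) *m B| <= eta * b.
    apply: (le_trans (mulmx_norm_le _ _)); rewrite mulrC ler_wpM2r//.
    by rewrite /eta mulrC.
  have k3 : `|tau *: ((g y0 - g x0) *m A)| <= eta.
    rewrite normrZ gtr0_norm// /eta ler_wpM2l ?(ltW tau0)//.
    apply: (le_trans (mulmx_norm_le _ _)).
    apply: (@le_trans _ _ (a * ((1 + b) * (c + 1) * tau))); first by rewrite ler_wpM2l.
    apply: le_trans tauq; rewrite !mulrA mulrC ler_wpM2l ?(ltW tau0)// /q.
    by rewrite [a * a + _]addrC -addrA lerDl addr_ge0.
  apply: bracket_error_le; first exact: ltW.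
  apply: le_trans (ler_normD _ _) _; rewrite lerD//.
  by apply: le_trans (ler_normD _ _) _; rewrite normrN lerD.
have C3eta : 0 <= C3 * eta by rewrite mulr_ge0// ltW.
have := approx_move_reparam (tau^-1%:M : 'M[R]_1) C3eta scaled.
rewrite mul_scalar_mx scalerA mulVf ?gt_eqF// scale1r.
apply: approx_move_le.
have -> : opnorm (tau^-1%:M : 'M[R]_1) = tau^-1.
  rewrite opnorm_rv rv1_norm mxE eqxx mulr1n ger0_norm// invr_ge0 ltW//.
rewrite (_ : C3 * eta * (1 + tau^-1) = C3 * tau * w + C3 * w); last first.
  by rewrite /eta mulrDr mulr1 mulrA [_ * w]mulrAC mulfK ?gt_eqF// -mulrA mulrAC.
apply: le_trans wC3.
rewrite [leRHS](_ : _ = C3 * w + C3 * w); last by ring.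
rewrite lerD2r.
by rewrite ler_wpM2r ?(ltW w0)// ler_piMr// ltW.
Qed.

End bracket.

(** * Calculus in charts *)

Section charts.
Variables (R : realType) (N : nat) (M : topologicalType).
Variable A : smooth_manifold R N M.
Local Notation V := 'rV[R]_N.

Lemma is_derive_chain (W W' : normedModType R) (f : W -> W') (u : R -> W) (t : R) e :
  differentiable f (u t) -> is_derive t (1 : R) u e ->
  is_derive t (1 : R) (f \o u) ('D_e f (u t)).
Proof.
move=> df [du ue]; have /derivable1_diffP du' := du.
have dfu : differentiable (f \o u) t by exact: differentiable_comp.
apply: DeriveDef; first by apply/derivable1_diffP.
rewrite deriveE// diff_comp//= deriveE//; congr ('d f _ _).
by rewrite -ue deriveE.
Qed.

Lemma derive_chain (W1 W2 W3 : normedModType R) (f : W1 -> W2) (h : W2 -> W3) x e :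
  differentiable f x -> differentiable h (f x) ->
  'D_('D_e f x) h (f x) = 'D_e (h \o f) x.
Proof.
move=> df dh; have dhf : differentiable (h \o f) x by exact: differentiable_comp.
by rewrite (deriveE _ dh) (deriveE _ df) (deriveE _ dhf) (diff_comp df dh).
Qed.

Definition chart_img (q : M) : set V := chart A q @` chart_dom A q.

Lemma chart_invK q x : chart_img q x -> chart A q (chart_inv A q x) = x.
Proof. by move=> [v qv <-]; rewrite chartK. Qed.

Lemma chart_inv_dom q x : chart_img q x -> chart_dom A q (chart_inv A q x).
Proof. by move=> [v qv <-]; rewrite chartK. Qed.

Lemma chart_img_mem q v : chart_dom A q v -> chart_img q (chart A q v).
Proof. by move=> qv; exists v. Qed.

Lemma near_chart_img q x : chart_img q x -> \forall y \near x, chart_img q y.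
Proof. by move=> qx; apply: open_nbhs_nbhs; split=> //; exact: chart_img_open. Qed.

Lemma near_chart_imgI q x (U : set M) : open U -> chart_img q x ->
  U (chart_inv A q x) ->
  \forall y \near x, chart_img q y /\ U (chart_inv A q y).
Proof.
move=> oU qx Ux; near=> y; split; first by near: y; exact: near_chart_img.
near: y; apply: (chart_inv_continuous qx).
exact: open_nbhs_nbhs.
Unshelve. all: by end_near. Qed.

Lemma chart_imgI q x (U : set M) : chart_img q x /\ U (chart_inv A q x) <->
  (chart A q @` (chart_dom A q `&` U)) x.
Proof.
split=> [[qx Ux]|[v [qv Uv] <-]]; last by rewrite chartK//; split=> //; exists v.
by exists (chart_inv A q x); [split=> //; exact: chart_inv_dom|exact: chart_invK].
Qed.

Definition transition (q q' : M) : V -> V := chart A q' \o chart_inv A q.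

Lemma transition_C1 q q' x : chart_img q x -> chart_dom A q' (chart_inv A q x) ->
  differentiable (transition q q') x /\
  forall e, {for x, continuous (fun y => 'D_e (transition q q') y)}.
Proof.
move=> qx q'x; have [h1 h2] := @chart_smooth _ _ _ A q q' 1%N.
have xI : (chart A q @` (chart_dom A q `&` chart_dom A q')) x by apply/chart_imgI.
by split=> [|e]; [exact: h1|exact: (h2 e)].
Qed.

Lemma transitionK q q' x : chart_img q x -> chart_dom A q' (chart_inv A q x) ->
  \forall y \near x, transition q' q (transition q q' y) = y.
Proof.
move=> qx q'x; have [oq' _] := chart_domP A q'.
near=> y; have [qy q'y] : chart_img q y /\ chart_dom A q' (chart_inv A q y).
  by near: y; exact: near_chart_imgI.
by rewrite /transition/= chartK// chart_invK.
Unshelve. all: by end_near. Qed.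

Lemma transition_derK q q' x e : chart_img q x ->
  chart_dom A q' (chart_inv A q x) ->
  'D_('D_e (transition q q') x) (transition q' q) (transition q q' x) = e.
Proof.
move=> qx q'x; have [d1 _] := transition_C1 qx q'x.
have q'Tx : chart_img q' (transition q q' x) by exact: chart_img_mem.
have qTx : chart_dom A q (chart_inv A q' (transition q q' x)).
  by rewrite /transition/= chartK//; exact: chart_inv_dom.
have [d2 _] := transition_C1 q'Tx qTx.
rewrite (derive_chain _ d1 d2).
rewrite (@near_eq_derive _ _ _ _ id); first exact: derive_id.
by near=> y => /=; near: y; exact: transitionK.
Unshelve. all: by end_near. Qed.

Lemma chart_center v : chart_dom A v v. Proof. by case: (chart_domP A v). Qed.

Lemma tvecK q v xi : chart_dom A q v -> tvec A q v (tcoord A q v xi) = xi.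
Proof.
move=> qv; have vv := chart_center v.
have := @transition_derK v q (chart A v v) xi (chart_img_mem vv).
by rewrite /tvec/tcoord /transition/= chartK//; apply.
Qed.

Lemma is_derive_chart q q' (u : R -> V) t e :
  chart_img q (u t) -> chart_dom A q' (chart_inv A q (u t)) ->
  is_derive t (1 : R) u e ->
  is_derive t (1 : R) (chart A q' \o (chart_inv A q \o u)) ('D_e (transition q q') (u t)).
Proof.
move=> qu q'u; apply: (@is_derive_chain _ _ (transition q q') u).
by case: (transition_C1 qu q'u).
Qed.

Lemma has_velocity_chart q (u : R -> V) t e : chart_img q (u t) ->
  is_derive t (1 : R) u e ->
  has_velocity A (chart_inv A q \o u) t (tvec A q (chart_inv A q (u t)) e).
Proof.
move=> qu du; rewrite /has_velocity.
have := is_derive_chart qu (chart_center _) du.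
by rewrite /tvec chart_invK.
Qed.

Lemma tvec_local_field q (X : vfield R N M) x : chart_img q x ->
  tvec A q (chart_inv A q x) (local_field A q X x) = X (chart_inv A q x).
Proof. by move=> qx; rewrite tvecK//; exact: chart_inv_dom. Qed.

Lemma tvecN q v e : chart_dom A q v -> tvec A q v (- e) = - tvec A q v e.
Proof.
move=> qv; have qx := chart_img_mem qv.
have [d _] := @transition_C1 q v _ qx (eq_ind_r (chart_dom A v) (chart_center v) (chartK qv)).
by rewrite /tvec -/(transition q v) !deriveE// linearN.
Qed.

Lemma near_sum_dist_le (W W' : normedModType R) (I : finType) (F : I -> W -> W')
    (x0 : W) (w : R) :
  (forall i, {for x0, continuous (F i)}) -> 0 < w ->
  \forall x \near x0, \sum_i `|F i x - F i x0| <= w.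
Proof.
move=> cF w0; have k0 : 0 < #|I|%:R + 1 :> R by rewrite ltr_wpDl.
have w'0 : 0 < w / (#|I|%:R + 1) by rewrite divr_gt0.
near=> x; apply: (@le_trans _ _ (\sum_(i : I) (w / (#|I|%:R + 1)))).
  apply: ler_sum => i _; rewrite distrC; move: i; near: x.
  by apply: filter_forall => i; exact: (@cvgr_dist_le _ _ _ _ _ (F i) (F i x0) (cF i) _ w'0).
rewrite sumr_const -[leLHS]mulr_natl mulrCA ler_piMr ?ltW// ltr_pdivrMr//.
by rewrite mul1r ltrDl.
Unshelve. all: by end_near. Qed.

(** Along the segment from [y] to [x] the derivative of [f] differs little from
    its derivative at [x0], by continuity of the partial derivatives, so the mean
    value inequality applies to [f] minus its linear part. *)
Lemma C1_strictly_diff (O : set V) (f : V -> V) x0 : open O -> O x0 ->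
  Ck_on 1 O f -> strictly_diff f x0 (jacobian f x0).
Proof.
move=> oO Ox0 [df cf] w w0.
pose S (x : V) := \sum_i `|'D_(delta_mx 0 i : V) f x - 'D_(delta_mx 0 i : V) f x0|.
have nS : \forall x \near x0, S x <= w.
  apply: (@near_sum_dist_le V V _ (fun i x => 'D_(delta_mx 0 i : V) f x)) => // i.
  exact: (cf (delta_mx 0 i) x0 Ox0).
have : \forall x \near x0, O x /\ S x <= w.
  by apply: filterI => //; exact: open_nbhs_nbhs.
move=> /nbhs_ballP[r /= r0 hr].
exists (r / 2); first exact: divr_gt0.
move=> x y xr yr; pose z (t : R) := y + t *: (x - y).
have zr (t : R) : t \in `[0, 1] -> ball x0 r (z t).
  rewrite in_itv/= => /andP[t0 t1].
  rewrite mx_norm_ball /ball_/= distrC.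
  rewrite (_ : z t - x0 = t *: (x - x0) + (1 - t) *: (y - x0)); last first.
    by rewrite /z; apply/rowP => i; rewrite !mxE; ring.
  rewrite (le_lt_trans (ler_normD _ _))// !normrZ.
  rewrite ger0_norm// ger0_norm ?subr_ge0//.
  apply: (@le_lt_trans _ _ (t * (r / 2) + (1 - t) * (r / 2))).
    by rewrite lerD// ler_wpM2l// subr_ge0.
  lra.
have dz t : is_derive t (1 : R) z (x - y).
  have h1 : is_derive t (1 : R) (cst y : R -> V) 0 by exact: is_derive_cst.
  by have := is_deriveD h1 (is_derive_lin (x - y) t); rewrite add0r.
pose G t := f (z t) - t *: ((x - y) *m jacobian f x0).
have dG (t : R) : t \in `[0, 1] -> is_derive t (1 : R) G
    ('D_(x - y) f (z t) - (x - y) *m jacobian f x0).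
  move=> t01; apply: is_derive_sub; last exact: is_derive_lin.
  by apply: (@is_derive_chain _ _ f z) => //; apply: df; case: (hr _ (zr t t01)).
have := @mean_value_le R N G _ 0 1 (w * `|x - y|) ler01 dG.
rewrite /G /z scale0r scale1r subrKC addr0 scale1r scale0r subr0 subr0 mulr1.
rewrite addrAC; apply=> // t t01.
have [Oz Sz] := hr _ (zr t t01).
rewrite deriveEjacobian; last exact: df.
rewrite -mulmxBr.
have hE (D : 'M[R]_N) : (x - y) *m D = \sum_i (x - y) 0 i *: (delta_mx 0 i *m D).
  rewrite {1}[x - y]row_sum_delta mulmx_suml.
  by apply: eq_bigr => i _; rewrite scalemxAl.
rewrite hE.
apply: (le_trans (ler_norm_sum _ _ _)).
apply: (@le_trans _ _ (S (z t) * `|x - y|)); last by rewrite ler_wpM2r.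
rewrite /S mulr_suml ler_sum// => i _.
rewrite normrZ mulrC ler_pM//; last exact: rv_coord_le.
have dE p : O p -> delta_mx 0 i *m jacobian f p = 'D_(delta_mx 0 i : V) f p.
  by move=> /df dp; rewrite deriveEjacobian.
rewrite -(dE _ Oz) -(dE _ Ox0).
move: (jacobian f (z t)) (jacobian f x0) => J1 J0.
by rewrite mulmxBr lexx.
Qed.

End charts.

(** * Joining points by curves at rest at their ends *)

Section smoothstep.
Variable R : realType.

Definition sqpos (x : R) : R := Num.max x 0 * x.

Lemma is_derive_sqpos (x : R) : is_derive x (1 : R) sqpos (2 * Num.max x 0).
Proof.
have [x0|x0|->] := ltgtP x 0.
- rewrite mulr0.
  apply: (@near_eq_is_derive _ _ _ (cst (0 : R))).
  near=> y; have y0 : y < 0 by near: y; exact: lt_nbhsl.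
  by rewrite /sqpos (max_idPr (ltW y0)) mul0r.
- have h : is_derive x (1 : R) (fun y : R => y * y) (2 * x).
    apply: is_derive_eq.
    by rewrite /GRing.scale/= mulr1 mulr_natl mulr2n.
  apply: near_eq_is_derive h.
  near=> y; have y0 : 0 < y by near: y; exact: lt_nbhsr.
  by rewrite /sqpos (max_idPl (ltW y0)).
- rewrite mulr0.
  have c0 : (fun h : R => h^-1 *: (sqpos (h *: (1 : R) + 0) - sqpos 0)) @ 0^' --> (0 : R).
    apply/cvgrPdist_le => e e0; near=> h.
    rewrite sub0r normrN /sqpos mulr0 subr0 addr0 [h *: _]mulr1.
    have h0 : h != 0 by near: h; exact: nbhs_dnbhs_neq.
    rewrite [_ *: _]mulrCA mulVf// mulr1.
    apply: (@le_trans _ _ `|h|).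
      by case: (leP h 0) => ?; rewrite ?normr0.
    by near: h; exact: dnbhs0_le.
  apply: DeriveDef; first by apply/cvg_ex; exists 0; exact: c0.
  exact: cvg_lim c0.
Unshelve. all: by end_near. Qed.

(** A C^1 function rising from 0 to 1 between 0 and 1 and constant elsewhere: its
    derivative is the hat function of height 2. *)
Definition smoothstep (x : R) : R :=
  2 * sqpos x - 4 * sqpos (x - 2^-1) + 2 * sqpos (x - 1).

Definition dsmoothstep (x : R) : R :=
  4 * Num.max x 0 - 8 * Num.max (x - 2^-1) 0 + 4 * Num.max (x - 1) 0.

Lemma is_derive_smoothstep x : is_derive x (1 : R) smoothstep (dsmoothstep x).
Proof.
have sh a : is_derive x (1 : R) (fun y => sqpos (y - a)) (2 * Num.max (x - a) 0).
  have h : is_derive x (1 : R) (fun y : R => y - a) 1.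
    by apply: is_derive_eq; rewrite subr0.
  have := @is_derive1_comp R sqpos (fun y : R => y - a) x _ _
    (is_derive_sqpos (x - a)) h.
  by rewrite mulr1.
have h0 := is_derive_sqpos x; have h1 := sh 2^-1; have h2 := sh 1.
rewrite /smoothstep; apply: is_derive_eq.
rewrite /dsmoothstep /GRing.scale/=; ring.
Qed.

Lemma smoothstep_le0 x : x <= 0 -> smoothstep x = 0.
Proof.
move=> x0; rewrite /smoothstep /sqpos.
by rewrite !(max_idPr _)//; lra.
Qed.

Lemma smoothstep_ge1 x : 1 <= x -> smoothstep x = 1.
Proof.
move=> x1; rewrite /smoothstep /sqpos.
by rewrite !(max_idPl _); lra.
Qed.

Lemma smoothstep_itv x : 0 <= smoothstep x <= 1.
Proof.
rewrite /smoothstep /sqpos; case: (leP x 0) => h1; case: (leP (x - 2^-1) 0) => h2;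
  case: (leP (x - 1) 0) => h3; try lra; apply/andP; split; nra.
Qed.

Lemma dsmoothstep_itv x : 0 <= dsmoothstep x <= 2.
Proof.
rewrite /dsmoothstep; case: (leP x 0) => h1; case: (leP (x - 2^-1) 0) => h2;
  case: (leP (x - 1) 0) => h3; lra.
Qed.

Lemma dsmoothstep_continuous : continuous dsmoothstep.
Proof.
have maxc a : continuous (fun x : R => Num.max (x - a) 0).
  move=> x; apply/cvgrPdist_le => e e0; near=> y.
  apply: (@le_trans _ _ `|x - y|).
    by rewrite ler_norml; have := ler_norm (x - y); have := ler_norm (y - x);
      rewrite (distrC y); case: (leP (x - a) 0) => ?; case: (leP (y - a) 0) => ?; lra.
  by near: y; apply: cvgr_dist_le => //; exact: cvg_id.
have max0 : continuous (fun x : R => Num.max x 0).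
  by under eq_fun do rewrite -[X in Num.max X 0]subr0; exact: maxc.
move=> x; apply: cvgD; last by apply: cvgM; [exact: cvg_cst|exact: maxc].
apply: cvgB; first by apply: cvgM; [exact: cvg_cst|exact: max0].
by apply: cvgM; [exact: cvg_cst|exact: maxc].
Unshelve. all: by end_near. Qed.

End smoothstep.

Section joined.
Variables (R : realType) (N : nat) (M : topologicalType).
Variable A : smooth_manifold R N M.
Variable g : riemannian_metric A.
Local Notation V := 'rV[R]_N.

(** Curves that rest at both ends can be concatenated without losing
    differentiability, which replaces the triangle inequality of the
    Riemannian distance. *)
Definition joined (x y : M) (l : R) : Prop :=
  exists c : R -> M, [/\ C1_curve A c, forall r, r <= 0 -> c r = x,
    forall r, 1 <= r -> c r = y & forall r, speed g c r <= l].

Lemma joined_le x y l l' : l <= l' -> joined x y l -> joined x y l'.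
Proof.
move=> ll' [c [c1 c2 c3 c4]]; exists c; split=> // r.
exact: le_trans (c4 r) ll'.
Qed.

(** The integral of the speed is a supremum over the simple functions below it,
    which lie below the constant [l] as well. *)
Lemma riemannian_dist_le x y l : joined x y l -> riemannian_dist g x y <= l.
Proof.
move=> [c [c1 c2 c3 c4]].
have s0 (d : R -> M) r : 0 <= speed g d r by exact: sqrtr_ge0.
apply: (@le_trans _ _ (Rintegral lebesgue_measure `[0, 1] (speed g c))).
  apply: ge_inf.
    exists 0 => _ [d [_ _ _ ->]]; apply: Rintegral_ge0 => t _; exact: s0.
  by exists c; split=> //; [exact: c2|exact: c3].
have l0 : 0 <= l by exact: le_trans (s0 c 0) (c4 0).
have mu1 : (\int[@lebesgue_measure R]_(t in `[0%R, 1%R]) (l%:E) = l%:E)%E.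
  rewrite integral_cst//= lebesgue_measure_itv/= lte_fin ltr01.
  by rewrite oppr0 adde0 mule1.
have I1 : (\int[@lebesgue_measure R]_(t in `[0%R, 1%R]) (speed g c t)%:E
    <= l%:E)%E.
  rewrite -mu1 !ge0_integralE//=; last first.
  - by move=> t _; rewrite lee_fin.
  apply: le_ereal_sup => _ [h hle <-]; exists h => // t.
  apply: le_trans (hle t) _.
  by rewrite /patch; case: ifP => _ //; rewrite lee_fin.
rewrite /Rintegral -[leRHS]/(fine l%:E) fine_le//.
rewrite ge0_fin_numE; first by apply: le_lt_trans I1 _; exact: ltry.
by apply: integral_ge0 => t _; rewrite lee_fin.
Qed.

End joined.

Section joining.
Variables (R : realType) (N : nat) (M : topologicalType).
Variable A : smooth_manifold R N M.
Variable g : riemannian_metric A.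
Local Notation V := 'rV[R]_N.

Lemma near_eq_continuous (T U : topologicalType) (f h : T -> U) (t : T) :
  (\forall s \near t, f s = h s) -> {for t, continuous f} ->
  {for t, continuous h}.
Proof.
move=> fh cf; have ft := nbhs_singleton fh.
have ht : h s @[s --> t] --> f t := cvg_trans (near_eq_cvg fh) cf.
by move: ht; rewrite ft; exact.
Qed.

Lemma derive_sum_coord (W : normedModType R) (f : V -> W) (x v : V) :
  differentiable f x ->
  'D_v f x = \sum_i v 0 i *: 'D_(delta_mx 0 i : V) f x.
Proof.
move=> df; rewrite deriveE// [in LHS](row_sum_delta v) linear_sum.
by apply: eq_bigr => i _; rewrite linearZ/= deriveE.
Qed.

Lemma near_curve_dom (c : R -> M) t q : {for t, continuous c} ->
  chart_dom A q (c t) -> \forall s \near t, chart_dom A q (c s).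
Proof.
move=> cc qt; have [oq _] := chart_domP A q.
by apply: cc; exact: open_nbhs_nbhs.
Qed.

Lemma C1_curve_chart q (u du : R -> V) : (forall t, chart_img A q (u t)) ->
  (forall t, is_derive t (1 : R) u (du t)) -> continuous du ->
  C1_curve A (chart_inv A q \o u).
Proof.
move=> qu hu cdu.
have cu : continuous u by move=> t; exact: is_derive_cts (hu t).
have cc : continuous (chart_inv A q \o u).
  move=> t; apply: continuous_comp; first exact: cu.
  exact: (chart_inv_continuous (qu t)).
split=> // q' t q't; have near_q' := near_curve_dom (cc t) q't.
have hd s : chart_dom A q' (chart_inv A q (u s)) ->
    is_derive s (1 : R) (chart A q' \o (chart_inv A q \o u))
      ('D_(du s) (transition A q q') (u s)).
  by move=> q's; exact: (is_derive_chart (qu s) q's (hu s)).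
split; first by case: (hd _ q't).
pose F s := \sum_i du s 0 i *: 'D_(delta_mx 0 i : V) (transition A q q') (u s).
apply: (@near_eq_continuous _ _ F).
  near=> s; have q's : chart_dom A q' (chart_inv A q (u s)) by near: s.
  have [_ ] := hd _ q's; rewrite derive1E => ->.
  by rewrite derive_sum_coord//; case: (transition_C1 (qu s) q's).
have [_ cT] := transition_C1 (qu t) q't.
rewrite /continuous_at /F; apply: cvg_big => [|i _]; first exact: add_continuous.
apply: cvgZ.
  exact: (continuous_comp (cdu t) (@coord_continuous R 1 N 0 i (du t))).
exact: (continuous_comp (cu t) (cT (delta_mx 0 i))).
Unshelve. all: by end_near. Qed.

Lemma inner_sumE v k (a : 'I_k -> R) (t : 'I_k -> V) :
  inner g v (\sum_i a i *: t i) (\sum_i a i *: t i) =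
  \sum_i \sum_j a i * a j * inner g v (t i) (t j).
Proof.
rewrite /inner mulmx_suml mulmx_suml summxE; apply: eq_bigr => i _.
rewrite linear_sum mulmx_sumr summxE; apply: eq_bigr => j _.
by rewrite linearZ/= -!scalemxAl -scalemxAr !mxE mulrA.
Qed.

(** In coordinates the scalar product is a quadratic form with continuous
    coefficients, hence locally bounded by a multiple of the norm. *)
Lemma inner_bound q x0 : chart_img A q x0 ->
  exists2 B : R, 0 <= B & \forall x \near x0, forall h : V,
    Num.sqrt (inner g (chart_inv A q x) (tvec A q (chart_inv A q x) h)
                      (tvec A q (chart_inv A q x) h)) <= B * `|h|.
Proof.
move=> qx0.
pose G (ij : 'I_N * 'I_N) (x : V) : R := inner g (chart_inv A q x)
  (tvec A q (chart_inv A q x) (delta_mx 0 ij.1))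
  (tvec A q (chart_inv A q x) (delta_mx 0 ij.2)).
pose S := \sum_ij `|G ij x0| + 1.
have S0 : 0 <= S by rewrite addr_ge0// sumr_ge0.
exists (Num.sqrt S); first exact: sqrtr_ge0.
have nG : \forall x \near x0, \sum_ij `|G ij x - G ij x0| <= 1.
  apply: (@near_sum_dist_le R V R _ G) => // -[i j].
  exact: (@inner_smooth _ _ _ _ g q i j 0%N).
near=> x => h; have qx : chart_img A q x by near: x; exact: near_chart_img.
have xG : \sum_ij `|G ij x| <= S.
  have : \sum_ij `|G ij x - G ij x0| <= 1 by near: x.
  rewrite /S addrC -lerBlDr => /(le_trans _); apply; rewrite lerBlDr -big_split.
  apply: ler_sum => ij _ /=; rewrite -{1}(subrK (G ij x0) (G ij x)).
  exact: ler_normD.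
set v := chart_inv A q x.
have qv : chart_dom A q v by exact: chart_inv_dom.
have [dT _] := @transition_C1 _ _ _ A q v x qx (chart_center A v).
have -> : tvec A q v h = \sum_i h 0 i *: tvec A q v (delta_mx 0 i).
  by rewrite /tvec chart_invK// -/(transition A q v) (derive_sum_coord _ dT).
rewrite inner_sumE -[`|h|]normr_id -(sqrtr_sqr `|h|) -sqrtrM// ler_wsqrtr//.
rewrite pair_big/= (le_trans (ler_norm _))// (le_trans (ler_norm_sum _ _ _))//.
apply: (@le_trans _ _ (\sum_ij `|G ij x| * `|h| ^+ 2)); last first.
  by rewrite -mulr_suml ler_wpM2r// exprn_ge0.
apply: ler_sum => ij _; rewrite normrM mulrC ler_wpM2l// normrM expr2.
by rewrite ler_pM// rv_coord_le.
Unshelve. all: by end_near. Qed.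

(** The coordinate segment from [x] to [y], run with the speed of
    [smoothstep]. *)
Lemma chart_segment_joined q x0 : chart_img A q x0 ->
  exists (r B : R), [/\ 0 < r, 0 <= B,
    forall x, `|x - x0| <= r -> chart_img A q x
  & forall x y, `|x - x0| <= r -> `|y - x0| <= r ->
      joined g (chart_inv A q x) (chart_inv A q y) (B * `|y - x|)].
Proof.
move=> qx0; have [B B0 hB] := inner_bound qx0.
have : \forall x \near x0, chart_img A q x /\ forall h : V,
    Num.sqrt (inner g (chart_inv A q x) (tvec A q (chart_inv A q x) h)
                      (tvec A q (chart_inv A q x) h)) <= B * `|h|.
  by apply: filterI => //; exact: near_chart_img.
move=> /nbhs_ballP[r /= r0 hr].
have rr x : `|x - x0| <= r / 2 -> ball x0 r x.
  by rewrite mx_norm_ball /ball_/= distrC => h; apply: le_lt_trans h _; lra.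
exists (r / 2), (B * 2); split.
- by rewrite divr_gt0.
- by rewrite mulr_ge0.
- by move=> x /rr/hr[].
move=> x y xr yr.
pose u (t : R) := x + smoothstep t *: (y - x).
pose du (t : R) := dsmoothstep t *: (y - x).
have ur t : `|u t - x0| <= r / 2.
  have /andP[t0 t1] := smoothstep_itv t; set s := smoothstep t in t0 t1.
  rewrite (_ : u t - x0 = s *: (y - x0) + (1 - s) *: (x - x0)); last first.
    by rewrite /u -/s; apply/rowP => i; rewrite !mxE; ring.
  rewrite (le_trans (ler_normD _ _))// !normrZ ger0_norm// ger0_norm ?subr_ge0//.
  apply: (@le_trans _ _ (s * (r / 2) + (1 - s) * (r / 2))).
    by rewrite lerD// ler_wpM2l// subr_ge0.
  lra.
have qu t : chart_img A q (u t) by case: (hr _ (rr _ (ur t))).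
have hu t : is_derive t (1 : R) u (du t).
  apply: is_derive_rv => i.
  rewrite (_ : (fun s => u s 0 i) =
    (fun s : R => x 0 i + smoothstep s * (y 0 i - x 0 i))); last first.
    by apply/funext => s; rewrite !mxE.
  have := is_derive_smoothstep t => ?.
  apply: is_derive_eq.
  by rewrite /du /GRing.scale/= !mxE; ring.
have cdu : continuous du.
  move=> t; apply: cvgZ; [exact: dsmoothstep_continuous|exact: cvg_cst].
exists (chart_inv A q \o u); split.
- exact: (C1_curve_chart qu hu cdu).
- by move=> t t0; rewrite /= /u smoothstep_le0// scale0r addr0.
- by move=> t t1; rewrite /= /u smoothstep_ge1// scale1r subrKC.
move=> t; rewrite /speed.
have [_ ] := has_velocity_chart (qu t) (hu t).
rewrite -derive1E => ->.
have [_ /(_ (du t))] := hr _ (rr _ (ur t)).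
move=> /le_trans; apply; rewrite -mulrA ler_wpM2l// /du normrZ ler_wpM2r//.
by have /andP[d0 d2] := dsmoothstep_itv t; rewrite ger0_norm.
Qed.

End joining.

Section concatenation.
Variables (R : realType) (N : nat) (M : topologicalType).
Variable A : smooth_manifold R N M.
Variable g : riemannian_metric A.
Local Notation V := 'rV[R]_N.

Lemma affine_is_derive (a b t : R) :
  is_derive t (1 : R) (fun s : R => a * s + b) a.
Proof. by apply: is_derive_eq; rewrite /GRing.scale/= mulr1 addr0. Qed.

Lemma derive1_affine (f : R -> V) (a b t : R) : derivable f (a * t + b) 1 ->
  is_derive t (1 : R) (fun s => f (a * s + b)) (a *: derive1 f (a * t + b)).
Proof.
move=> /derivable1_diffP df.
have := @is_derive_chain R R V f (fun s => a * s + b) t a df (affine_is_derive a b t).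
suff -> : 'D_a f (a * t + b) = a *: derive1 f (a * t + b) by [].
by rewrite derive1E !deriveE// -linearZ /= [a *: _]mulr1.
Qed.

Lemma C1_curve_affine (c : R -> M) (a b : R) : C1_curve A c ->
  C1_curve A (fun t => c (a * t + b)).
Proof.
move=> [cc c1]; have ca : continuous (fun s : R => a * s + b).
  by move=> t; exact/differentiable_continuous/derivable1_diffP.
have cca : continuous (fun t => c (a * t + b)).
  move=> t; exact: (continuous_comp (ca t) (cc _)).
split=> // q t qt.
have nq := near_curve_dom (cca t) qt.
have hd s : chart_dom A q (c (a * s + b)) -> is_derive s (1 : R)
    (chart A q \o (fun t => c (a * t + b)))
    (a *: derive1 (chart A q \o c) (a * s + b)).
  by move=> qs; apply: derive1_affine; case: (c1 _ _ qs).
split; first by case: (hd _ qt).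
apply: (@near_eq_continuous _ _
  (fun s => a *: derive1 (chart A q \o c) (a * s + b))).
  near=> s; have qs : chart_dom A q (c (a * s + b)) by near: s.
  by have [_ h] := hd _ qs; rewrite -h [RHS]derive1E.
have [_ cd] := c1 _ _ qt.
apply: cvgZ; first exact: cvg_cst.
exact: (continuous_comp (ca t) cd).
Unshelve. all: by end_near. Qed.

Lemma innerZ v (a : R) (xi : V) :
  inner g v (a *: xi) (a *: xi) = a ^+ 2 * inner g v xi xi.
Proof.
rewrite /inner -!scalemxAl linearZ/= -scalemxAr mxE [in LHS]mxE.
by rewrite mulrA expr2.
Qed.

Lemma speed_affine (c : R -> M) (a b t : R) : 0 <= a -> C1_curve A c ->
  speed g (fun t => c (a * t + b)) t = a * speed g c (a * t + b).
Proof.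
move=> a0 [_ c1]; rewrite /speed; set p := c (a * t + b).
have [dv _] := c1 p _ (chart_center A p).
have [_ ] := derive1_affine dv; rewrite -derive1E.
move: (derive1 _ (a * t + b)) => xi.
move: (derive1 _ t) => eta ->.
rewrite innerZ sqrtrM ?sqr_ge0// sqrtr_sqr ger0_norm//.
Qed.

Definition glue (c : R) (e1 e2 : R -> M) (t : R) : M :=
  if t <= c then e1 t else e2 t.

Section glue.
Variables (c : R) (e1 e2 : R -> M) (y : M).
Hypotheses (C1 : C1_curve A e1) (C2 : C1_curve A e2).
Hypothesis e1y : forall t, c <= t -> e1 t = y.
Hypothesis e2y : forall t, t <= c -> e2 t = y.

Lemma near_glue_lt t : t < c -> \forall s \near t, e1 s = glue c e1 e2 s.
Proof.
move=> tc; near=> s; rewrite /glue ifT//.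
by apply: ltW; near: s; exact: lt_nbhsl.
Unshelve. all: by end_near. Qed.

Lemma near_glue_gt t : c < t -> \forall s \near t, e2 s = glue c e1 e2 s.
Proof.
move=> tc; near=> s; rewrite /glue ifF//.
by apply/negbTE; rewrite -ltNge; near: s; exact: lt_nbhsr.
Unshelve. all: by end_near. Qed.

(** In a chart the glued curve is a sum, because each piece is constant where the
    other one runs; this gives its derivative at the junction. *)
Lemma glue_chart q t : chart A q (glue c e1 e2 t) =
  chart A q (e1 t) + chart A q (e2 t) - chart A q y.
Proof.
rewrite /glue; case: leP => tc; first by rewrite (e2y tc) addrK.
by rewrite (e1y (ltW tc)) addrAC subrr add0r.
Qed.

Lemma near_eq_derive1 (f h : R -> V) (t : R) : (\forall s \near t, f s = h s) ->
  derive1 f t = derive1 h t.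
Proof. by move=> fh; rewrite !derive1E; exact: near_eq_derive. Qed.

Lemma near_near_eq_derive1 (f h : R -> V) (t : R) : (\forall s \near t, f s = h s) ->
  \forall s \near t, derive1 f s = derive1 h s.
Proof.
move=> fh; have := @nbhs_interior R t _ fh.
by apply: filterS => s hs; exact: near_eq_derive1.
Qed.

Lemma C1_at_near (d d' : R -> M) q (t : R) : (\forall s \near t, d s = d' s) ->
  derivable (chart A q \o d) t 1 /\ {for t, continuous (derive1 (chart A q \o d))} ->
  derivable (chart A q \o d') t 1 /\ {for t, continuous (derive1 (chart A q \o d'))}.
Proof.
move=> dd [h1 h2].
have cdd : \forall s \near t, (chart A q \o d) s = (chart A q \o d') s.
  by apply: filterS dd => s /= ->.
split; first exact: near_eq_derivable h1.
exact: near_eq_continuous (near_near_eq_derive1 cdd) h2.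
Qed.

Lemma glue_C1 : C1_curve A (glue c e1 e2).
Proof.
have [cc1 d1] := C1; have [cc2 d2] := C2.
have ey1 : e1 c = y by exact: e1y.
have ey2 : e2 c = y by exact: e2y.
split=> [t|q t qt].
  have [tc|tc|->] := ltgtP t c.
  - exact: near_eq_continuous (near_glue_lt tc) (cc1 t).
  - exact: near_eq_continuous (near_glue_gt tc) (cc2 t).
  - have gc : glue c e1 e2 c = y by rewrite /glue lexx.
    suff : glue c e1 e2 s @[s --> c] --> y by rewrite -gc; exact.
    move=> U yU.
    have h1 : \forall s \near c, U (e1 s) by apply: cc1; rewrite ey1.
    have h2 : \forall s \near c, U (e2 s) by apply: cc2; rewrite ey2.
    apply: filterS2 h1 h2 => s h1 h2.
    by rewrite /= /glue; case: ifP.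
have [tc|tc|tc] := ltgtP t c.
- apply: C1_at_near (near_glue_lt tc) (d1 _ _ _).
  by move: qt; rewrite /glue ltW.
- apply: C1_at_near (near_glue_gt tc) (d2 _ _ _).
  by move: qt; rewrite /glue leNgt tc.
rewrite {t}tc in qt *.
have qy : chart_dom A q y by move: qt; rewrite /glue lexx ey1.
have q1 : chart_dom A q (e1 c) by rewrite ey1.
have q2 : chart_dom A q (e2 c) by rewrite ey2.
have E : chart A q \o glue c e1 e2 =
    (fun t => (chart A q \o e1) t + (chart A q \o e2) t - chart A q y).
  by apply/funext => s; rewrite /= glue_chart.
have hd s : chart_dom A q (e1 s) -> chart_dom A q (e2 s) ->
  is_derive s (1 : R) (chart A q \o glue c e1 e2)
    (derive1 (chart A q \o e1) s + derive1 (chart A q \o e2) s).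
  move=> /d1[h1 _] /d2[h2 _]; rewrite E !derive1E.
  have := derivableP h1; have := derivableP h2 => k2 k1.
  have kc : is_derive s (1 : R) (fun _ : R => chart A q y) 0 by exact: is_derive_cst.
  by have := is_derive_sub (is_deriveD k1 k2) kc; rewrite subr0.
split; first by case: (hd c q1 q2).
apply: (@near_eq_continuous _ _ (fun s =>
   derive1 (chart A q \o e1) s + derive1 (chart A q \o e2) s)).
  have n1 := near_curve_dom (cc1 c) q1; have n2 := near_curve_dom (cc2 c) q2.
  near=> s; have k1 : chart_dom A q (e1 s) by near: s.
  have k2 : chart_dom A q (e2 s) by near: s.
  by have [_ h] := hd _ k1 k2; rewrite -h [RHS]derive1E.
have [_ k1] := d1 _ _ q1; have [_ k2] := d2 _ _ q2.
exact: (cvgD k1 k2).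
Unshelve. all: by end_near. Qed.

(** The first curve comes to rest at the junction, its velocity being
    continuous. *)
Lemma glue_rest : derive1 (chart A y \o e1) c = 0.
Proof.
have [cc1 d1] := C1; have ey1 : e1 c = y by exact: e1y.
have q1 : chart_dom A y (e1 c) by rewrite ey1; exact: chart_center.
have [_ cd] := d1 _ _ q1.
apply: (@cvg_unique _ _ (derive1 (chart A y \o e1) @ c^'+)).
- exact: norm_hausdorff.
- exact: cvg_at_right_filter.
- apply: cvg_near_cst; near=> s.
  rewrite (@near_eq_derive1 _ (cst (chart A y y))) ?derive1_cst//.
  near=> r => /=; rewrite e1y//.
  by apply: ltW; near: r; apply: lt_nbhsr; near: s; exact: nbhs_right_gt.
Unshelve. all: by end_near. Qed.

Lemma glue_speed t : speed g (glue c e1 e2) t = speed g e1 t \/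
                     speed g (glue c e1 e2) t = speed g e2 t.
Proof.
have [cc1 d1] := C1; have [cc2 d2] := C2.
have ey1 : e1 c = y by exact: e1y.
have ey2 : e2 c = y by exact: e2y.
have key (d : R -> M) : (\forall s \near t, d s = glue c e1 e2 s) ->
    speed g (glue c e1 e2) t = speed g d t.
  move=> dE; have dt := nbhs_singleton dE; rewrite /speed -dt.
  rewrite (@near_eq_derive1 (chart A (d t) \o glue c e1 e2) (chart A (d t) \o d))//.
  by apply: filterS dE => s /= ->.
have [tc|tc|tc] := ltgtP t c.
- by left; apply: key; exact: near_glue_lt.
- by right; apply: key; exact: near_glue_gt.
right; rewrite tc /speed.
have -> : glue c e1 e2 c = y by rewrite /glue lexx.
rewrite ey2.
suff -> : derive1 (chart A y \o glue c e1 e2) c = derive1 (chart A y \o e2) c by [].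
have q1 : chart_dom A y (e1 c) by rewrite ey1; exact: chart_center.
have q2 : chart_dom A y (e2 c) by rewrite ey2; exact: chart_center.
have [h1 _] := d1 _ _ q1; have [h2 _] := d2 _ _ q2.
have E : chart A y \o glue c e1 e2 =
    (fun t => (chart A y \o e1) t + (chart A y \o e2) t - chart A y y).
  by apply/funext => s; rewrite /= glue_chart.
have kc : is_derive c (1 : R) (fun _ : R => chart A y y) 0 by exact: is_derive_cst.
have [_ ] := is_derive_sub (is_deriveD (derivableP h1) (derivableP h2)) kc.
rewrite -E -!derive1E => ->.
by rewrite glue_rest add0r subr0.
Qed.

End glue.

(** Both curves are run at double speed, whence the factor 2. *)
Lemma joined_trans x y z l1 l2 :
  joined g x y l1 -> joined g y z l2 -> joined g x z (2 * Num.max l1 l2).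
Proof.
move=> [c1 [h1 x1 y1 s1]] [c2 [h2 y2 z2 s2]].
pose e1 t := c1 (2 * t + 0); pose e2 t := c2 (2 * t + - 1).
have E1 : C1_curve A e1 by exact: C1_curve_affine.
have E2 : C1_curve A e2 by exact: C1_curve_affine.
have e1y t : 2^-1 <= t -> e1 t = y by move=> ht; apply: y1; lra.
have e2y t : t <= 2^-1 -> e2 t = y by move=> ht; apply: y2; lra.
exists (glue 2^-1 e1 e2); split.
- exact: glue_C1 E1 E2 e1y e2y.
- by move=> r r0; rewrite /glue ifT; [apply: x1; lra|lra].
- move=> r r1; rewrite /glue ifF; first by apply: z2; lra.
  by apply/negbTE; rewrite -ltNge; lra.
- move=> r; have [->|->] := glue_speed E1 E2 e1y e2y r.
    rewrite speed_affine// ler_wpM2l// (le_trans (s1 _))//.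
    by rewrite le_max lexx.
  rewrite speed_affine// ler_wpM2l// (le_trans (s2 _))//.
  by rewrite le_max lexx orbT.
Qed.

End concatenation.

(** * Reachable points *)

Section reachability.
Variables (R : realType) (N : nat) (M : topologicalType).
Variable A : smooth_manifold R N M.
Variable g : riemannian_metric A.
Variable K : carnot_structure A.
Local Notation V := 'rV[R]_N.

Definition lipschitz_curve (a L : R) (c : R -> M) : Prop :=
  forall s t, 0 <= s -> s <= t -> t <= a -> joined g (c s) (c t) (L * (t - s)).

(** Continuity is two-sided at the endpoints, so that the segment can be shifted
    along the parameter axis. *)
Definition horizontal_segment (a : R) (c : R -> M) : Prop :=
  exists (p : M) (i : 'I_N), [/\ (i < dimH K 1)%N,
    forall r, r \in `[0, a] -> {for r, continuous c},
    forall r, r \in `[0, a] -> frame_dom K p (c r)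
  & (forall r, r \in `]0, a[ -> has_velocity A c r (frame K p i (c r))) \/
    (forall r, r \in `]0, a[ -> has_velocity A c r (- frame K p i (c r)))].

Inductive reach : M -> M -> Prop :=
| reach_refl x : reach x x
| reach_step x (c : R -> M) a L : 0 <= a -> horizontal_segment a c ->
    lipschitz_curve a L c -> reach x (c 0) -> reach x (c a).

Lemma reach_trans x y z : reach x y -> reach y z -> reach x z.
Proof.
move=> xy yz; elim: yz x xy => // w c a L a0 hc lc _ IH x xw.
exact: (reach_step a0 hc lc (IH _ xw)).
Qed.

(** Symmetric by definition: the integral lines of a flow provide the segments in
    both directions at once. *)
Definition creach (q : M) (x y : V) : Prop :=
  reach (chart_inv A q x) (chart_inv A q y) /\
  reach (chart_inv A q y) (chart_inv A q x).

Lemma creach_refl q x : creach q x x.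
Proof. by split; exact: reach_refl. Qed.

Lemma creach_trans q x y z : creach q x y -> creach q y z -> creach q x z.
Proof.
by move=> [xy yx] [yz zy]; split; [exact: reach_trans yz|exact: reach_trans yx].
Qed.

Lemma C1_field_differentiable U (X : vfield R N M) q x : C1_field A U X ->
  chart_img A q x -> U (chart_inv A q x) -> differentiable (local_field A q X) x.
Proof. by move=> /(_ q)[h _] qx Ux; apply: h; apply/chart_imgI. Qed.

(** Solutions in the chart are integral lines of the frame field, run forwards or
    backwards; the sign [sg] treats both orientations together. *)
Lemma flow_reachable_frame p (i : 'I_N) q x0 : (i < dimH K 1)%N ->
  chart_img A q x0 -> frame_dom K p (chart_inv A q x0) ->
  flow_reachable (creach q) (local_field A q (frame K p i)) x0.
Proof.
move=> i1 qx0 Ux0; set X := frame K p i; set f := local_field A q X.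
have [oU _] := frame_domP K p.
have [XC1 _ _ _ _] := frameP K p.
have [r [B [r0 B0 _ hB]]] := @chart_segment_joined R N M A g q x0 qx0.
have cf : \forall x \near x0, `|f x - f x0| <= 1.
  have df := C1_field_differentiable (XC1 i) qx0 Ux0.
  have := @near_sum_dist_le R V V 'I_1 (fun _ => f) x0 1.
  move=> /(_ (fun _ => differentiable_continuous df) ltr01).
  by apply: filterS => x; rewrite big_ord1.
have : \forall x \near x0, (chart_img A q x /\ frame_dom K p (chart_inv A q x)) /\
    `|f x - f x0| <= 1.
  by apply: filterI => //; exact: near_chart_imgI.
move=> /nbhs_ballP[r' /= r'0 hr'].
exists (Num.min r (r' / 2)); first by rewrite lt_min r0 divr_gt0.
move=> u T hu.
have hu1 t : `|t| <= T -> [/\ chart_img A q (u t),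
    frame_dom K p (chart_inv A q (u t)), `|f (u t)| <= `|f x0| + 1,
    is_derive t (1 : R) u (f (u t)) & `|u t - x0| <= r].
  move=> /hu[du]; rewrite le_min => /andP[ur ur'].
  have [|[h1 h2] h3] := hr' (u t).
    by rewrite mx_norm_ball /ball_/= distrC; apply: le_lt_trans ur' _; lra.
  split=> //; rewrite -(subrK (f x0) (f (u t))) addrC.
  by rewrite (le_trans (ler_normD _ _))// lerD.
pose C := `|f x0| + 1.
have C0 : 0 <= C by rewrite addr_ge0.
have seg (sg t1 a : R) : sg = 1 \/ sg = - 1 -> 0 <= a ->
    (forall r, 0 <= r -> r <= a -> `|sg * r + t1| <= T) ->
    reach (chart_inv A q (u t1)) (chart_inv A q (u (sg * a + t1))).
  move=> hsg a0 hT; pose w r := u (sg * r + t1).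
  pose c := chart_inv A q \o w.
  have -> : chart_inv A q (u t1) = c 0 by rewrite /c /w /= mulr0 add0r.
  have dw s : 0 <= s -> s <= a -> is_derive s (1 : R) w (sg *: f (w s)).
    move=> s0 sa; have [_ _ _ [du ue] _] := hu1 _ (hT s s0 sa).
    have := derive1_affine du; rewrite derive1E.
    by rewrite -/(w s) ue.
  apply: (@reach_step _ c a (B * C)) => //; last exact: reach_refl.
    exists p, i; split=> //.
    - move=> s; rewrite in_itv/= => /andP[s0 sa].
      have [qs _ _ _ _] := hu1 _ (hT s s0 sa).
      exact: (continuous_comp (is_derive_cts (dw s s0 sa)) (chart_inv_continuous qs)).
    - move=> s; rewrite in_itv/= => /andP[s0 sa].
      by have [_ Us _ _ _] := hu1 _ (hT s s0 sa).
    - have vel s : s \in `]0, a[ -> has_velocity A c s (sg *: X (c s)).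
        rewrite in_itv/= => /andP[/ltW s0 /ltW sa].
        have [qs _ _ _ _] := hu1 _ (hT s s0 sa).
        have := has_velocity_chart (u := w) qs (dw s s0 sa).
        congr (has_velocity A _ _ _).
        case: hsg => ->; rewrite ?scale1r ?scaleN1r; first exact: tvec_local_field.
        by rewrite tvecN ?tvec_local_field//; exact: chart_inv_dom.
      case: hsg vel => -> vel; [left|right] => s sa; move: (vel s sa).
        by rewrite scale1r.
      by rewrite scaleN1r.
  move=> s t s0 st ta.
  have sa : s <= a by exact: le_trans ta.
  have t0 : 0 <= t by exact: le_trans st.
  have [_ _ _ _ hs] := hu1 _ (hT s s0 sa).
  have [_ _ _ _ ht] := hu1 _ (hT t t0 ta).
  apply: joined_le (hB _ _ hs ht).
  rewrite -mulrA ler_wpM2l//.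
  apply: (@mean_value_le R N w (fun r => sg *: f (w r))) => // z.
    by rewrite in_itv/= => /andP[? ?]; apply: dw; lra.
  rewrite in_itv/= => /andP[? ?].
  have [|_ _ hf _ _] := hu1 (sg * z + t1); first by apply: hT; lra.
  rewrite normrZ (_ : `|sg| = 1) ?mul1r//.
  by case: hsg => ->; rewrite ?normrN normr1.
move=> t tT; have [t0|t0] := leP 0 t.
- split.
    have := seg 1 0 t (or_introl erefl) t0; rewrite mul1r addr0; apply.
    move=> s s0 st; rewrite mul1r addr0 ger0_norm//.
    by apply: le_trans st _; rewrite -(ger0_norm t0).
  have := seg (-1) t t (or_intror erefl) t0; rewrite mulN1r addNr; apply.
  move=> s s0 st; rewrite mulN1r addrC ger0_norm ?subr_ge0//.
  by move: tT; rewrite ger0_norm//; lra.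
- have nt0 : 0 <= - t by lra.
  move: tT; rewrite ltr0_norm// => tT; split.
    have := seg (-1) 0 (- t) (or_intror erefl) nt0.
    rewrite mulN1r opprK addr0; apply=> s s0 st.
    by rewrite mulN1r addr0 normrN ger0_norm//; lra.
  have := seg 1 t (- t) (or_introl erefl) nt0; rewrite mul1r addNr; apply.
  move=> s s0 st; rewrite mul1r ler0_norm//; lra.
Qed.

(** Movability of a tangent vector at [v], in the chart singled out around [v];
    this is the chart in which brackets at [v] are computed. *)
Definition mov (v : M) (xi : V) : Prop := movable (creach v) (chart A v v) xi.

Lemma transition_inv q q' x : chart_img A q x -> chart_dom A q' (chart_inv A q x) ->
  chart_inv A q' (transition A q q' x) = chart_inv A q x.
Proof. by move=> qx q'x; rewrite /transition/= chartK. Qed.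

Lemma transition_strictly_diff q q' x : chart_img A q x ->
  chart_dom A q' (chart_inv A q x) ->
  strictly_diff (transition A q q') x (jacobian (transition A q q') x).
Proof.
move=> qx q'x; have [oq' _] := chart_domP A q'.
have /nbhs_ballP[r /= r0 hr] := near_chart_imgI oq' qx q'x.
apply: (@C1_strictly_diff R N (ball x r)).
- exact: ball_open.
- exact: ballxx.
by split=> [y|e y] /hr[qy q'y]; case: (transition_C1 qy q'y).
Qed.

(** The moves around [y] are conjugated by the coordinate change.  This is what
    allows the induction over brackets to use, at points near [v], directions
    known to be movable in the charts of those points. *)
Lemma mov_tcoord q y (xi : V) : chart_dom A q y -> mov y xi ->
  movable (creach q) (chart A q y) (tcoord A q y xi).
Proof.
move=> qy my e e0.
set x0 := chart A q y; set y0 := chart A y y.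
have yy0 : chart_img A y y0 by exact/chart_img_mem/chart_center.
have qx0 : chart_img A q x0 by exact: chart_img_mem.
have iy0 : chart_inv A y y0 = y by rewrite chartK//; exact: chart_center.
have ix0 : chart_inv A q x0 = y by rewrite chartK.
have qy0 : chart_dom A q (chart_inv A y y0) by rewrite iy0.
have yx0 : chart_dom A y (chart_inv A q x0) by rewrite ix0; exact: chart_center.
set J := jacobian (transition A y q) y0; set J' := jacobian (transition A q y) x0.
have [d1 _] := transition_C1 yy0 qy0; have [d2 _] := transition_C1 qx0 yx0.
have JJ (z : V) : z *m (J' *m J - 1%:M) = 0.
  rewrite mulmxBr mulmx1 mulmxA -!deriveEjacobian//.
  have := transition_derK z qx0 yx0.
  by rewrite {2}/transition /= ix0 => ->; rewrite subrr.
have tE : tcoord A q y xi = xi *m J by rewrite -deriveEjacobian.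
have sd1 : strictly_diff (transition A y q) y0 J by exact: transition_strictly_diff.
have sd2 : strictly_diff (transition A q y) x0 J' by exact: transition_strictly_diff.
clearbody J J'.
pose b := opnorm J + opnorm J' + 1; pose l := `|xi|.
have b1 : 1 <= b by rewrite /b; have := opnorm_ge0 J; have := opnorm_ge0 J'; lra.
pose c := 4 * (b + 1) ^+ 2 + l.
have c0 : 0 < c.
  have b20 : 0 < (b + 1) ^+ 2 by rewrite exprn_gt0//; lra.
  have l0 : 0 <= l by exact: normr_ge0.
  by rewrite /c; lra.
pose h := Num.min 1 (e / (2 * c)).
have h0 : 0 < h by rewrite /h lt_min ltr01 divr_gt0// mulr_gt0.
have h1 : h <= 1 by rewrite /h ge_min lexx.
have hc : c * (h + h) <= e.
  have : h <= e / (2 * c) by rewrite /h ge_min lexx orbT.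
  by rewrite ler_pdivlMr ?mulr_gt0//; lra.
have [r1 r10 hr1] := sd1 _ h0.
have [r2 r20 hr2] := sd2 _ h0.
have [oq _] := chart_domP A q; have [oy _] := chart_domP A y.
have /nbhs_ballP[r3 /= r30 hr3] := near_chart_imgI oq yy0 qy0.
have /nbhs_ballP[r4 /= r40 hr4] := near_chart_imgI oy qx0 yx0.
pose rho := Num.min (Num.min r1 r2) (Num.min (r3 / 2) (r4 / 2)).
have rho0 : 0 < rho by rewrite /rho !lt_min r10 r20 !divr_gt0.
have rho1 : rho <= r1 by rewrite /rho !ge_min lexx.
have rho2 : rho <= r2 by rewrite /rho !ge_min lexx orbT.
have rho3 : rho < r3.
  by apply: (@le_lt_trans _ _ (r3 / 2)); [rewrite /rho !ge_min lexx !orbT|lra].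
have rho4 : rho < r4.
  by apply: (@le_lt_trans _ _ (r4 / 2)); [rewrite /rho !ge_min lexx !orbT|lra].
rewrite tE; apply: approx_move_le hc _.
apply: (@approx_move_conj R N (creach y) (creach q) (transition A y q)
  (transition A q y) x0 y0 J J' 1 xi h h rho b l) => //.
- by rewrite (ltW h0).
- by rewrite (ltW h0).
- exact: normr_ge0.
- by rewrite /transition /= ix0.
- by rewrite /transition /= iy0.
- by move=> z z' zr z'r; apply: hr1; [exact: le_trans rho1|exact: le_trans rho1].
- by move=> z z' zr z'r; apply: hr2; [exact: le_trans rho2|exact: le_trans rho2].
- by move=> z; rewrite JJ normr0 mulr_ge0// ltW.
- move=> z; rewrite (le_trans (mulmx_norm_le _ _))// ler_wpM2r//.
  by rewrite /b; have := opnorm_ge0 J'; lra.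
- move=> z; rewrite (le_trans (mulmx_norm_le _ _))// ler_wpM2r//.
  by rewrite /b; have := opnorm_ge0 J; lra.
- by move=> s; rewrite (le_trans (mulmx_norm_le _ _))// opnorm_rv.
- move=> x z xr zr.
  have [|yz qz] := hr3 z.
    by rewrite mx_norm_ball /ball_/= distrC; exact: le_lt_trans rho3.
  have [|qx yx] := hr4 x.
    by rewrite mx_norm_ball /ball_/= distrC; exact: le_lt_trans rho4.
  by rewrite /creach (transition_inv qx yx) (transition_inv yz qz).
- exact: my.
Qed.

Lemma tcoord_center v xi : tcoord A v v xi = xi.
Proof.
rewrite /tcoord (@near_eq_derive _ _ _ _ id); first exact: derive_id.
have vv := chart_img_mem (chart_center A v).
by apply: filterS (near_chart_img vv) => y vy; rewrite /= chart_invK.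
Qed.

Lemma mov_field p (i : 'I_N) v : (i < dimH K 1)%N -> frame_dom K p v ->
  mov v (frame K p i v).
Proof.
move=> i1 Uv; have vv := chart_center A v; have vx := chart_img_mem vv.
have Ux : frame_dom K p (chart_inv A v (chart A v v)) by rewrite chartK.
have := flow_reachable_frame i1 vx Ux.
set f := local_field A v (frame K p i) => hf.
have -> : frame K p i v = f (chart A v v).
  by rewrite /f /local_field chartK// tcoord_center.
apply: movable_flow hf.
have [XC1 _ _ _ _] := frameP K p; have [oU _] := frame_domP K p.
have /nbhs_ballP[r /= r0 hr] := near_chart_imgI oU vx Ux.
apply: (@C1_strictly_diff R N (ball (chart A v v) r)).
- exact: ball_open.
- exact: ballxx.
have [h1 h2] := XC1 i v.
by split=> [x|e x] /hr xU; [apply: h1|apply: h2]; apply/chart_imgI.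
Qed.

Lemma mov_bracket p (i k : 'I_N) v : (i < dimH K 1)%N -> frame_dom K p v ->
  (forall y, frame_dom K p y -> mov y (frame K p k y)) ->
  mov v (lie_bracket A (frame K p i) (frame K p k) v).
Proof.
move=> i1 Uv mk; have vv := chart_center A v; have vx := chart_img_mem vv.
have Ux : frame_dom K p (chart_inv A v (chart A v v)) by rewrite chartK.
have hf := flow_reachable_frame i1 vx Ux.
have [XC1 _ _ _ _] := frameP K p; have [oU _] := frame_domP K p.
have /nbhs_ballP[r /= r0 hr] := near_chart_imgI oU vx Ux.
have sd j : strictly_diff (local_field A v (frame K p j)) (chart A v v)
    (jacobian (local_field A v (frame K p j)) (chart A v v)).
  apply: (@C1_strictly_diff R N (ball (chart A v v) r)).
  - exact: ball_open.
  - exact: ballxx.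
  have [h1 h2] := XC1 j v.
  by split=> [x|e x] /hr xU; [apply: h1|apply: h2]; apply/chart_imgI.
have dj j : differentiable (local_field A v (frame K p j)) (chart A v v).
  exact: C1_field_differentiable (XC1 j) vx Ux.
have fE j : local_field A v (frame K p j) (chart A v v) = frame K p j v.
  by rewrite /local_field chartK// tcoord_center.
have r20 : 0 < r / 2 by rewrite divr_gt0.
rewrite /lie_bracket !deriveEjacobian//.
rewrite -[in X in X *m _ - _]fE -[in X in _ - X *m _]fE.
apply: (movable_bracket (@creach_trans v) r20 (sd i) hf).
- move=> w /(sd k)[r1 r10 h1]; exists r1 => // x xr.
  by apply: h1 => //; rewrite subrr normr0 ltW.
- move=> x xr; have [|vx' Ux'] := hr x.
    by rewrite mx_norm_ball /ball_/= distrC; apply: le_lt_trans xr _; lra.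
  rewrite /local_field -{1}(chart_invK vx').
  by apply: mov_tcoord; [exact: chart_inv_dom|exact: mk].
Qed.

End reachability.

(** * Generation of the tangent space by brackets *)

Section generation.
Variables (R : realType) (N : nat).
Local Notation V := 'rV[R]_N.

Lemma span_ind (P : V -> Prop) (s : seq V) : P 0 ->
  (forall x y, P x -> P y -> P (x + y)) -> (forall a x, P x -> P (a *: x)) ->
  (forall x, x \in s -> P x) -> forall z, z \in << s >>%VS -> P z.
Proof.
move=> P0 PD PZ Ps z /(@coord_span _ _ _ (in_tuple s)) ->.
by apply: big_ind => // i _; apply: PZ; apply: Ps; rewrite mem_nth.
Qed.

(** Expansion of the bracket of two combinations with constant coefficients,
    [T k w] standing for the derivative of the field [x k] in the direction
    [w]. *)
Lemma bracket_expand (T : 'I_N -> V -> V) (P Q : pred 'I_N) (a b : 'I_N -> R)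
    (x : 'I_N -> V) :
  (forall (I : pred 'I_N) (s : 'I_N -> R) k,
     T k (\sum_(i | I i) s i *: x i) = \sum_(i | I i) s i *: T k (x i)) ->
  \sum_(k | Q k) b k *: T k (\sum_(i | P i) a i *: x i) -
  \sum_(i | P i) a i *: T i (\sum_(k | Q k) b k *: x k) =
  \sum_(i | P i) \sum_(k | Q k) (a i * b k) *: (T k (x i) - T i (x k)).
Proof.
move=> lin; rewrite [RHS]exchange_big /=.
have -> : \sum_(i | P i) a i *: T i (\sum_(k | Q k) b k *: x k) =
    \sum_(k | Q k) \sum_(i | P i) (a i * b k) *: T i (x k).
  rewrite exchange_big /=; apply: eq_bigr => i _; rewrite lin scaler_sumr.
  by apply: eq_bigr => k _; rewrite scalerA.
rewrite -sumrB; apply: eq_bigr => k _; rewrite lin scaler_sumr -sumrB.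
by apply: eq_bigr => i _; rewrite scalerBr scalerA mulrC.
Qed.

Lemma near_line (x0 h : V) (P : V -> Prop) : (\forall x \near x0, P x) ->
  \forall t \near (0 : R)^', P (t *: h + x0).
Proof.
move=> Px.
have h1 : is_derive (0 : R) (1 : R) (fun _ : R => x0) 0 by exact: is_derive_cst.
have c : t *: h + x0 @[t --> (0 : R)] --> 0 *: h + x0 :=
  is_derive_cts (is_deriveD (is_derive_lin h 0) h1).
rewrite scale0r add0r in c.
have : \forall t \near (0 : R), P (t *: h + x0) by exact: (c _ Px).
exact: cvg_within.
Qed.

(** The difference quotients of [D] lie in the span of the [e k x], and as the
    frame is nearly constant their coordinates stay bounded; hence the
    coordinates outside [P] of the limit, taken in the frame at [x0], are
    arbitrarily small. *)
Lemma derive_in_span (e : 'I_N -> V -> V) (P : pred 'I_N) (D : V -> V) (x0 h : V) :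
  (forall k, {for x0, continuous (e k)}) ->
  free [tuple e k x0 | k < N] -> derivable D x0 h -> D x0 = 0 ->
  (\forall x \near x0, exists c : 'I_N -> R, D x = \sum_(k | P k) c k *: e k x) ->
  exists c : 'I_N -> R, 'D_h D x0 = \sum_(k | P k) c k *: e k x0.
Proof.
move=> ce fe dD D0 hD.
pose E x : 'M[R]_N := \matrix_k e k x.
have mulE (u : V) x : u *m E x = \sum_k u 0 k *: e k x.
  by rewrite mulmx_sum_row; apply: eq_bigr => k _; rewrite rowK.
have E0u : E x0 \in unitmx.
  rewrite -row_free_unit; apply: inj_row_free => u; rewrite mulE => u0.
  apply/rowP => k; rewrite mxE.
  move/freeP : fe => /(_ (fun k => u 0 k)); apply.
  by rewrite -[RHS]u0; apply: eq_bigr => i _; rewrite -tnth_nth tnth_mktuple.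
set I := invmx (E x0); set d := 'D_h D x0.
suff dk k : ~~ P k -> (d *m I) 0 k = 0.
  exists (fun k => (d *m I) 0 k).
  transitivity (d *m I *m E x0); first by rewrite mulmxKV.
  rewrite mulE (bigID P)/= addrC big1 ?add0r// => k Pk.
  by rewrite dk// scale0r.
move=> Pk; apply/eqP; rewrite -normr_le0; apply/ler_addgt0Pr => eps eps0.
rewrite add0r.
pose b := opnorm I; have b0 : 0 <= b := opnorm_ge0 I.
pose C := b * (`|d| + 1).
have C0 : 0 <= C by rewrite mulr_ge0// addr_ge0.
(* bounds on the displacement of the frame and on the difference quotient *)
pose w := Num.min 2^-1 (eps / (4 * C + 1)) / (b + 1).
have D10 : 0 < 4 * C + 1 by lra.
have D20 : 0 < b + 1 by lra.
have w0 : 0 < w by rewrite divr_gt0// lt_min invr_gt0 ltr0n divr_gt0.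
pose w' := Num.min 1 (eps / (2 * (b + 1))).
have w'0 : 0 < w' by rewrite lt_min ltr01 divr_gt0// mulr_gt0.
have n1 : \forall x \near x0, \sum_i `|e i x - e i x0| <= w.
  exact: (@near_sum_dist_le R V V _ e x0 w ce w0).
have n12 : \forall x \near x0, \sum_i `|e i x - e i x0| <= w /\
    exists c : 'I_N -> R, D x = \sum_(k | P k) c k *: e k x by exact: filterI.
have n2 := near_line h n12.
have n3 : \forall t \near (0 : R)^', `|d - t^-1 *: (D (t *: h + x0) - D x0)| <= w'.
  move/cvgrPdist_le : (dD) => /(_ _ w'0); exact.
have [t [[nt [c Dc]] qt]] : exists t : R,
   (\sum_i `|e i (t *: h + x0) - e i x0| <= w /\
    exists c : 'I_N -> R, D (t *: h + x0) = \sum_(k | P k) c k *: e k (t *: h + x0)) /\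
   `|d - t^-1 *: (D (t *: h + x0) - D x0)| <= w'.
  near ((0 : R)^') => t; exists t; split; first by near: t; exact: n2.
  by near: t; exact: n3.
set x := t *: h + x0 in nt Dc qt *.
set q := t^-1 *: (D x - D x0) in qt *.
pose u : V := \row_k (if P k then t^-1 * c k else 0).
have qE : q = u *m E x.
  rewrite /q D0 subr0 Dc scaler_sumr mulE [RHS](bigID P)/= [X in _ + X]big1.
    by rewrite addr0; apply: eq_bigr => i Pi; rewrite mxE Pi scalerA.
  by move=> i /negbTE Pi; rewrite mxE Pi scale0r.
pose Dl := (E x - E x0) *m I.
have Dlb : opnorm Dl <= b * w.
  rewrite /opnorm; apply: (@le_trans _ _ (\sum_i b * `|e i x - e i x0|)).
    apply: ler_sum => i _; rewrite row_mul (le_trans (mulmx_norm_le _ _))//.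
    by rewrite ler_wpM2l// linearB/= !rowK.
  by rewrite -mulr_sumr ler_wpM2l.
have bw : b * w <= Num.min 2^-1 (eps / (4 * C + 1)).
  rewrite /w mulrCA ler_piMr//.
    by rewrite le_min invr_ge0 ler0n divr_ge0// ltW.
  by rewrite ler_pdivrMr// mul1r; lra.
have Dl2 : opnorm Dl <= 2^-1.
  by apply: le_trans Dlb (le_trans bw _); rewrite ge_min lexx.
have DlC : opnorm Dl * (4 * C + 1) <= eps.
  rewrite -ler_pdivlMr//.
  by apply: le_trans Dlb (le_trans bw _); rewrite ge_min lexx orbT.
have qI : q *m I = u + u *m Dl.
  rewrite qE /Dl mulmxA mulmxBr mulmxBl -!mulmxA mulmxV// mulmx1.
  by rewrite addrC subrK.
have q1 : `|q| <= `|d| + 1.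
  rewrite -[q](subKr d) (le_trans (ler_normB _ _))// lerD//.
  by apply: le_trans qt _; rewrite ge_min lexx.
have qIC : `|q *m I| <= C.
  by rewrite (le_trans (mulmx_norm_le _ _))// ler_wpM2l.
have u2 : `|u| <= 2 * C.
  have h1 : `|u| <= `|q *m I| + `|u *m Dl|.
    by rewrite qI -{1}(addrK (u *m Dl) u) ler_normB.
  have h2 : `|u *m Dl| <= 2^-1 * `|u|.
    by rewrite (le_trans (mulmx_norm_le _ _))// ler_wpM2r.
  lra.
have h1 : `|(q *m I) 0 k| <= eps / 2.
  rewrite qI mxE [u 0 k]mxE (negbTE Pk) add0r.
  apply: le_trans (rv_coord_le _ _) _.
  apply: le_trans (mulmx_norm_le _ _) _.
  apply: (@le_trans _ _ (opnorm Dl * (2 * C))).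
    by rewrite ler_wpM2l// opnorm_ge0.
  have := opnorm_ge0 Dl => ?.
  by move: DlC; rewrite mulrDr mulr1; lra.
have h2 : `|((d - q) *m I) 0 k| <= eps / 2.
  apply: le_trans (rv_coord_le _ _) _.
  apply: le_trans (mulmx_norm_le _ _) _.
  apply: (@le_trans _ _ ((b + 1) * w')).
    by rewrite ler_pM// /b lerDl.
  have : w' <= eps / (2 * (b + 1)) by rewrite ge_min lexx orbT.
  by rewrite ler_pdivlMr ?mulr_gt0//; lra.
rewrite -[d](subrK q) mulmxDl mxE (le_trans (ler_normD _ _))//; lra.
Unshelve. all: by end_near. Qed.

End generation.

Section carnot.
Variables (R : realType) (N : nat) (M : topologicalType).
Variable A : smooth_manifold R N M.
Variable g : riemannian_metric A.
Variable K : carnot_structure A.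
Local Notation V := 'rV[R]_N.
Local Notation mov := (mov g K).

Lemma mov_sum v (I : Type) (r : seq I) (P : pred I) (F : I -> V) :
  (forall i, P i -> mov v (F i)) -> mov v (\sum_(i <- r | P i) F i).
Proof. exact: (movable_sum (@creach_refl _ _ _ A g K v) (@creach_trans _ _ _ A g K v)). Qed.

Lemma movD v (x y : V) : mov v x -> mov v y -> mov v (x + y).
Proof. exact: (movableD (@creach_trans _ _ _ A g K v)). Qed.

Lemma movZ v a (x : V) : mov v x -> mov v (a *: x).
Proof. exact: movableZ. Qed.

Lemma movB v (x y : V) : mov v x -> mov v y -> mov v (x - y).
Proof. by move=> hx hy; apply: movD => //; rewrite -scaleN1r; exact: movZ. Qed.

Lemma mem_take_frame (X : 'I_N -> vfield R N M) v d x :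
  x \in take d (frame_at X v) -> exists2 k : 'I_N, (k < d)%N & x = X k v.
Proof.
move=> /(nthP 0)[i]; rewrite size_take_min leq_min size_tuple => /andP[id iN] <-.
exists (Ordinal iN) => //; rewrite nth_take//.
by rewrite -[i in LHS]/(val (Ordinal iN)) -tnth_nth tnth_mktuple.
Qed.

Lemma mov_filtration (X : 'I_N -> vfield R N M) j v z :
  (forall k : 'I_N, (k < dimH K j)%N -> mov v (X k v)) ->
  z \in filtration (dimH K) X j v -> mov v z.
Proof.
move=> hX; apply: span_ind.
- exact: (movable0 (@creach_refl _ _ _ A g K v)).
- exact: movD.
- exact: movZ.
- by move=> x /mem_take_frame[k kd ->]; exact: hX.
Qed.

Lemma filtration_coords (X : 'I_N -> vfield R N M) j v z :
  z \in filtration (dimH K) X j v ->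
  exists c : 'I_N -> R, z = \sum_(k < N | (k < dimH K j)%N) c k *: X k v.
Proof.
move: z; apply: span_ind.
- by exists (fun=> 0); rewrite big1// => k _; rewrite scale0r.
- move=> x y [a ->] [b ->]; exists (fun k => a k + b k).
  by rewrite -big_split; apply: eq_bigr => k _; rewrite scalerDl.
- move=> a x [b ->]; exists (fun k => a * b k).
  by rewrite scaler_sumr; apply: eq_bigr => k _; rewrite scalerA.
- move=> x /mem_take_frame[k kd ->]; exists (fun i => (i == k)%:R).
  rewrite (bigD1 k)//= eqxx scale1r big1 ?addr0// => i /andP[_ /negbTE ->].
  by rewrite scale0r.
Qed.

Lemma local_field_sum (Y : vfield R N M) (X : 'I_N -> vfield R N M) (P : pred 'I_N)
    (c : 'I_N -> R) q x : chart_img A q x ->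
  Y (chart_inv A q x) = \sum_(k | P k) c k *: X k (chart_inv A q x) ->
  local_field A q Y x = \sum_(k | P k) c k *: local_field A q (X k) x.
Proof.
move=> qx; rewrite /local_field /tcoord; set y := chart_inv A q x => ->.
have yy := chart_center A y; have yx := chart_img_mem yy.
have [dT _] := @transition_C1 _ _ _ A y q _ yx (eq_ind_r (chart_dom A q) (chart_inv_dom qx) (chartK yy)).
rewrite -/(transition A y q) deriveE// linear_sum.
by apply: eq_bigr => k _; rewrite linearZ/= deriveE.
Qed.

(** The section [Y] is compared with the combination of the frame fields with the
    coefficients of [Y v] held constant: their difference vanishes at [v] and
    takes values in [H_j], so [derive_in_span] applies. *)
Lemma section_derive p j (Y : vfield R N M) v : frame_dom K p v ->
  section_of A (frame_dom K p) (filtration (dimH K) (frame K p) j) Y ->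
  let X := frame K p in let x0 := chart A v v in
  exists2 a : 'I_N -> R,
    Y v = \sum_(k < N | (k < dimH K j)%N) a k *: X k v &
    forall h, exists c : 'I_N -> R, 'D_h (local_field A v Y) x0 =
      \sum_(k < N | (k < dimH K j)%N) a k *: 'D_h (local_field A v (X k)) x0 +
      \sum_(k < N | (k < dimH K j)%N) c k *: X k v.
Proof.
move=> Uv [CY HY] X x0.
have [XC1 Xb _ _ _] := frameP K p; have [oU _] := frame_domP K p.
have vv := chart_center A v; have vx := chart_img_mem vv.
have Ux : frame_dom K p (chart_inv A v x0) by rewrite chartK.
have [a aE] := filtration_coords (HY v Uv).
have fE (Z : vfield R N M) : local_field A v Z x0 = Z v.
  by rewrite /local_field chartK// tcoord_center.
have dX k : differentiable (local_field A v (X k)) x0.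
  exact: C1_field_differentiable (XC1 k) vx Ux.
have dY : differentiable (local_field A v Y) x0.
  exact: C1_field_differentiable CY vx Ux.
exists a => // h.
pose S x := \sum_(k < N | (k < dimH K j)%N) a k *: local_field A v (X k) x.
have dS : is_derive x0 h S
    (\sum_(k < N | (k < dimH K j)%N) a k *: 'D_h (local_field A v (X k)) x0).
  pose F (k : 'I_N) (x : V) := (if (k < dimH K j)%N then a k else 0) *: local_field A v (X k) x.
  have -> : S = \sum_(k < N) F k.
    apply/funext => x; rewrite fct_sumE /S [LHS]big_mkcond; apply: eq_bigr => k _.
    by rewrite /F; case: ifP => //; rewrite scale0r.
  have -> : \sum_(k < N | (k < dimH K j)%N) a k *: 'D_h (local_field A v (X k)) x0 =
      \sum_(k < N) (if (k < dimH K j)%N then a k else 0) *: 'D_h (local_field A v (X k)) x0.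
    rewrite [LHS]big_mkcond; apply: eq_bigr => k _.
    by case: ifP => //; rewrite scale0r.
  apply: is_derive_sum => k.
  by apply: is_deriveZ; apply: derivableP; exact: diff_derivable.
have dYh : is_derive x0 h (local_field A v Y) ('D_h (local_field A v Y) x0).
  by apply: derivableP; exact: diff_derivable.
have dD : is_derive x0 h (fun x => local_field A v Y x - S x)
    ('D_h (local_field A v Y) x0 -
     \sum_(k < N | (k < dimH K j)%N) a k *: 'D_h (local_field A v (X k)) x0).
  exact: is_deriveB.
have [|||||c cE] := @derive_in_span R N (fun k => local_field A v (X k))
   (fun k => (k < dimH K j)%N) (fun x => local_field A v Y x - S x) x0 h.
- by move=> k; exact: differentiable_continuous (dX k).
- have /basis_free := Xb v Uv.
  congr (is_true (free _)); congr (tval _).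
  by apply: eq_mktuple => k; rewrite fE.
- by case: dD.
- rewrite fE aE /S; apply/eqP; rewrite subr_eq0; apply/eqP.
  by apply: eq_bigr => k _; rewrite fE.
- have nU := near_chart_imgI oU vx Ux.
  apply: filterS nU => x [qx Uqx].
  have [b bE] := filtration_coords (HY _ Uqx).
  exists (fun k => b k - a k).
  rewrite (local_field_sum qx bE) /S -sumrB.
  by apply: eq_bigr => k _; rewrite scalerBl.
- exists c; case: dD => _; rewrite cE => /eqP; rewrite eq_sym subr_eq => /eqP ->.
  by rewrite addrC; congr (_ + _); apply: eq_bigr => k _; rewrite fE.
Qed.

Lemma mov_section_bracket p j (Y Z : vfield R N M) v : frame_dom K p v ->
  section_of A (frame_dom K p) (filtration (dimH K) (frame K p) 1) Y ->
  section_of A (frame_dom K p) (filtration (dimH K) (frame K p) j) Z ->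
  (forall y (k : 'I_N), frame_dom K p y -> (k < dimH K j)%N ->
     mov y (frame K p k y)) ->
  mov v (lie_bracket A Y Z v).
Proof.
move=> Uv sY sZ hj; set X := frame K p in sY sZ hj *.
have [XC1 Xb _ _ _] := frameP K p; have [oU _] := frame_domP K p.
have vv := chart_center A v; have vx := chart_img_mem vv.
have Ux : frame_dom K p (chart_inv A v (chart A v v)) by rewrite chartK.
have [a aE hY] := section_derive Uv sY.
have [b bE hZ] := section_derive Uv sZ.
rewrite -/X in aE bE hY hZ.
have [c cE] := hZ (Y v); have [c' cE'] := hY (Z v).
have dX k : differentiable (local_field A v (X k)) (chart A v v).
  exact: C1_field_differentiable (XC1 k) vx Ux.
pose T k w := 'D_w (local_field A v (X k)) (chart A v v).
have lin (I : pred 'I_N) (s : 'I_N -> R) k :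
    T k (\sum_(i | I i) s i *: X i v) = \sum_(i | I i) s i *: T k (X i v).
  rewrite /T deriveE// linear_sum; apply: eq_bigr => i _.
  by rewrite linearZ/= deriveE.
have -> : lie_bracket A Y Z v =
    \sum_(i < N | (i < dimH K 1)%N) \sum_(k < N | (k < dimH K j)%N)
      (a i * b k) *: lie_bracket A (X i) (X k) v +
    (\sum_(k < N | (k < dimH K j)%N) c k *: X k v -
     \sum_(k < N | (k < dimH K 1)%N) c' k *: X k v).
  have E := bracket_expand (fun i : 'I_N => (i < dimH K 1)%N)
    (fun k : 'I_N => (k < dimH K j)%N) a b lin.
  have LE : lie_bracket A Y Z v =
    (\sum_(k < N | (k < dimH K j)%N) b k *: T k (Y v) +
     \sum_(k < N | (k < dimH K j)%N) c k *: X k v) -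
    (\sum_(i < N | (i < dimH K 1)%N) a i *: T i (Z v) +
     \sum_(k < N | (k < dimH K 1)%N) c' k *: X k v).
    exact: (congr2 (fun x y : V => x - y) cE cE').
  rewrite LE opprD addrACA aE bE E.
  by congr (_ + _).
apply: movD.
  apply: mov_sum => i i1; apply: mov_sum => k kj; apply: movZ.
  by apply: mov_bracket => // y Uy; exact: hj.
apply: movB; apply: mov_sum => k kj; apply: movZ; first exact: hj.
exact: mov_field.
Qed.

Lemma mov_frame p j : (1 <= j)%N -> (j <= depth K)%N ->
  forall y (k : 'I_N), frame_dom K p y -> (k < dimH K j)%N ->
    mov y (frame K p k y).
Proof.
elim: j => // j IH _ jd; have [->|j0] := posnP j.
  by move=> y k Uy k1; exact: mov_field.
have {}IH := IH j0 (ltnW jd).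
have [_ _ Xd _ Xg] := frameP K p.
move=> y k Uy kj.
have j1 : (1 <= j < depth K)%N by rewrite j0.
have zH : frame K p k y \in filtration (dimH K) (frame K p) j.+1 y.
  apply: memv_span; have kN : (k < size (frame_at (frame K p) y))%N by rewrite size_tuple.
  have -> : frame K p k y = nth 0 (take (dimH K j.+1) (frame_at (frame K p) y)) k.
    by rewrite nth_take// -tnth_nth tnth_mktuple.
  by rewrite mem_nth// size_take_min leq_min kj.
have [n [Y [Z [hYZ hz]]]] := Xg y Uy j j1 _ zH.
rewrite -[frame K p k y](subrK (\sum_(l < n) lie_bracket A (Y l) (Z l) y)).
apply: movD.
  by apply: mov_filtration hz => i ij; exact: IH.
apply: mov_sum => l _; have [sY sZ] := hYZ l.
exact: (mov_section_bracket Uy sY sZ IH).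
Qed.

Lemma mov_all v (xi : V) : mov v xi.
Proof.
have [oU Uv] := frame_domP K v; have [_ Xb _ _ _] := frameP K v.
have : xi \in filtration (dimH K) (frame K v) (depth K) v.
  rewrite /filtration dimH_depth take_oversize ?size_tuple//.
  by rewrite (span_basis (Xb v Uv)) memvf.
apply: mov_filtration => k kd; apply: (mov_frame (depth_gt0 K)) Uv kd.
exact: leqnn.
Qed.

(** Both directions are kept: the first makes the class of a point open, the second
    its complement. *)
Lemma near_reach v : \forall w \near v, reach g K v w /\ reach g K w v.
Proof.
have [r r0 hr] := movable_open (@creach_refl _ _ _ A g K v)
  (@creach_trans _ _ _ A g K v) (mov_all v).
have vv := chart_center A v; have [oV _] := chart_domP A v.
have n1 : \forall w \near v, chart_dom A v w by exact: open_nbhs_nbhs.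
have n2 : \forall w \near v, ball (chart A v v) r (chart A v w).
  exact: (chart_continuous vv) (nbhsx_ballx _ _ r0).
apply: filterS2 n1 n2 => w vw bw.
have := hr (chart A v w); rewrite /creach !chartK//; apply.
by move: bw; rewrite mx_norm_ball /ball_/= distrC => /ltW.
Qed.

Lemma reach_all : connected [set: M] -> forall v w, reach g K v w.
Proof.
move=> conn v w.
pose O := [set y | reach g K v y].
suff OT : O = setT by have : O w by rewrite OT.
apply: conn.
  - by exists v; exact: reach_refl.
  - exists O; last by rewrite setTI.
    rewrite openE => y vy; apply: filterS (near_reach y) => z [yz _].
    exact: reach_trans yz.
  - exists O; last by rewrite setTI.
    rewrite -(setCK O); apply: open_closedC; rewrite openE => y vy.
    apply: filterS (near_reach y) => z [yz zy] vz; apply: vy.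
    exact: reach_trans zy.
Qed.

End carnot.

(** * Paths composed of horizontal segments *)

Section paths.
Variables (R : realType) (N : nat) (M : topologicalType).
Variable A : smooth_manifold R N M.
Variable g : riemannian_metric A.
Variable K : carnot_structure A.
Local Notation V := 'rV[R]_N.

Definition segment_on (c : R -> M) (s t : R) : Prop :=
  exists (p : M) (i : 'I_N), (i < dimH K 1)%N /\
    integral_segment A (frame_dom K p) (frame K p i) c s t.

Lemma segment_on_eq c c' s t : (forall r, r \in `[s, t] -> c r = c' r) ->
  segment_on c s t -> segment_on c' s t.
Proof.
move=> cc' [p [i [i1 [h1 h2 h3]]]]; exists p, i; split=> //.
have oc r : r \in `]s, t[ -> r \in `[s, t] by exact: subset_itv_oo_cc.
have vel (X : vfield R N M) r : r \in `]s, t[ ->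
    has_velocity A c r (X (c r)) -> has_velocity A c' r (X (c' r)).
  move=> rst; have <- : c r = c' r by exact/cc'/oc.
  rewrite /has_velocity -(cc' r (oc r rst)).
  apply: near_eq_is_derive; near=> z => /=.
  rewrite (cc' z)//; apply: oc; near: z.
  exact: near_in_itvoo.
split.
- apply: subspace_eq_continuous h1 => r /[!inE]; exact: cc'.
- by move=> r rst; rewrite -cc'//; exact: h2.
case: h3 => h3; [left|right] => r rst.
  exact: vel (h3 r rst).
exact: (vel (fun v => - frame K p i v)) (h3 r rst).
Unshelve. all: by end_near. Qed.

Lemma hdim_gt0 : (0 < N)%N.
Proof.
rewrite -(dimH_depth K); have := depth_gt0 K.
rewrite leq_eqVlt => /predU1P[<-|d1]; first exact: dimH_gt0.
exact: ltn_trans (dimH_gt0 K) (dimH_lt (leqnn 1) d1 (leqnn _)).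
Qed.

Lemma segment_on_point c t : segment_on c t t.
Proof.
exists (c t), (Ordinal hdim_gt0); split; first exact: dimH_gt0.
have tt (r : R) : r \in `[t, t] -> r = t by rewrite in_itv/= => /le_anti.
have no (r : R) : r \in `]t, t[ -> False.
  by rewrite in_itv/= => /andP[/lt_trans h /h]; rewrite ltxx.
split.
- by rewrite set_itv1; exact: continuous_subspace1.
- by move=> r /tt ->; case: (frame_domP K (c t)).
- by left => r /no.
Qed.

Lemma segment_on_shift c o a : horizontal_segment K a c ->
  segment_on (fun r => c (r - o)) o (o + a).
Proof.
move=> [p [i [i1 hc hU hv]]]; exists p, i; split=> //.
have inc r : r \in `[o, o + a] -> r - o \in `[0, a].
  by rewrite !in_itv/= => /andP[? ?]; apply/andP; split; lra.
have ino r : r \in `]o, o + a[ -> r - o \in `]0, a[.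
  by rewrite !in_itv/= => /andP[? ?]; apply/andP; split; lra.
have sh : continuous (fun r : R => r - o).
  by move=> r; apply: cvgB; [exact: cvg_id|exact: cvg_cst].
have vel r xi : has_velocity A c (r - o) xi ->
    has_velocity A (fun r => c (r - o)) r xi.
  rewrite /has_velocity => -[d e].
  have := @derive1_affine R N (chart A (c (r - o)) \o c) 1 (- o) r.
  rewrite mul1r scale1r derive1E e => /(_ d).
  congr (is_derive r (1 : R) _ _).
  by apply/funext => s; rewrite /= mul1r.
split.
- apply: continuous_in_subspaceT => r /[!inE]/= /inc ra.
  exact: (continuous_comp (sh r) (hc _ ra)).
- by move=> r /inc/hU.
- by case: hv => hv; [left|right] => r /ino/hv/vel.
Qed.

(** The breakpoints [b] are eventually constant: the tail consists of one-point
    segments. *)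
Definition horizontal_path (a L : R) (gam : R -> M) (b : nat -> R) (n : nat) : Prop :=
  [/\ 0 <= a /\ 0 <= L, lipschitz_curve g a L gam,
      b 0%N = 0 /\ (forall k, b k <= b k.+1),
      forall k, (n <= k)%N -> b k = a
    & forall k, segment_on gam (b k) (b k.+1)].

Lemma breakpoints_le (b : nat -> R) i j : (forall k, b k <= b k.+1) ->
  (i <= j)%N -> b i <= b j.
Proof.
move=> hb; elim: j => [|j IH]; first by rewrite leqn0 => /eqP ->.
by rewrite leq_eqVlt => /predU1P[->//|/IH/le_trans]; apply.
Qed.

Lemma reach_path x y : reach g K x y -> exists a L gam b n,
  [/\ gam 0 = x, gam a = y & horizontal_path a L gam b n].
Proof.
elim=> [{}x|{}x c a' L' a'0 hc lc _ [a [L [gam [b [n [g0 ga hp]]]]]]].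
  exists 0, 0, (fun=> x), (fun=> 0), 0%N; split=> //; split=> //.
    move=> s t s0 st t0; rewrite mul0r.
    have vx := chart_img_mem (chart_center A x).
    have [r [B [r0 B0 _ hB]]] := @chart_segment_joined R N M A g _ _ vx.
    have := hB (chart A x x) (chart A x x).
    rewrite subrr normr0 chartK; last exact: chart_center.
    by rewrite mulr0; apply; exact: ltW.
  by move=> k; exact: segment_on_point.
have [[a0 L0] lg [b0 bS] bn seg] := hp.
have ba k : b k <= a.
  have [kn|nk] := leqP k n; last by rewrite bn// ltnW.
  by rewrite -(bn n (leqnn n)); exact: breakpoints_le.
pose gam' r := if r <= a then gam r else c (r - a).
pose b' k := if (k <= n)%N then b k else a + a'.
have ga' r : a <= r -> gam' r = c (r - a).
  rewrite /gam' le_eqVlt => /predU1P[<-|ar]; first by rewrite lexx subrr.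
  by rewrite leNgt ar.
have gl r : r <= a -> gam' r = gam r by rewrite /gam' => ->.
pose L1 := Num.max L `|L'|.
have L10 : 0 <= L1 by rewrite le_max L0.
exists (a + a'), (2 * L1), gam', b', n.+1; split.
- by rewrite gl.
- by rewrite ga' ?lerDl// addrAC subrr add0r.
split.
- by split; [exact: addr_ge0|exact: mulr_ge0].
- move=> s t s0 st ta.
  have [ta1|at1] := leP t a.
    rewrite !gl//; last exact: le_trans ta1.
    apply: joined_le (lg _ _ s0 st ta1); rewrite ler_wpM2r ?subr_ge0//.
    have : L <= L1 by rewrite le_max lexx.
    lra.
  have L'1 : L' <= L1 by rewrite le_max (ler_norm L') orbT.
  have [sa|as1] := leP s a.
    rewrite (gl _ sa) (ga' _ (ltW at1)).
    have j1 := lg s a s0 sa (lexx _); rewrite ga in j1.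
    have j2 : joined g (c 0) (c (t - a)) (L' * (t - a - 0)) by apply: lc; lra.
    apply: joined_le (joined_trans j1 j2).
    rewrite -mulrA ler_wpM2l// ge_max; apply/andP; split.
      apply: (@le_trans _ _ (L1 * (a - s))).
        by rewrite ler_wpM2r ?subr_ge0// le_max lexx.
      by rewrite ler_wpM2l//; lra.
    apply: (@le_trans _ _ (L1 * (t - a - 0))).
      by rewrite ler_wpM2r//; lra.
    by rewrite ler_wpM2l//; lra.
  rewrite !ga' ?ltW//.
  have j := lc (s - a) (t - a).
  apply: joined_le (j _ _ _); try lra.
  rewrite (_ : t - a - (s - a) = t - s); last by ring.
  by rewrite ler_wpM2r ?subr_ge0//; lra.
- split; first by rewrite /b' leq0n.
  move=> k; rewrite /b'; have [kn|nk|->] := ltngtP k n.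
  + exact: bS.
  + exact: lexx.
  + by rewrite bn// lerDl.
- by move=> k nk; rewrite /b' leqNgt nk.
- move=> k; rewrite /b'; have [kn|nk|->] := ltngtP k n.
  + apply: segment_on_eq (seg k) => r; rewrite in_itv/= => /andP[_ rb].
    by rewrite gl// (le_trans rb).
  + exact: segment_on_point.
  + rewrite bn//; apply: segment_on_eq (segment_on_shift a hc) => r.
    by rewrite in_itv/= => /andP[ar _]; rewrite ga'.
Qed.

Lemma breakpoint_between (b : nat -> R) n t : (forall k, b k <= b k.+1) ->
  b 0%N <= t -> t <= b n -> exists k, b k <= t <= b k.+1.
Proof.
move=> bS; elim: n => [|n IH] bt tb.
  by exists 0%N; rewrite bt (le_trans tb).
have [tn|nt] := leP t (b n); first exact: IH.
by exists n; rewrite (ltW nt).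
Qed.

Lemma path_dist_le a L gam b n s t : horizontal_path a L gam b n ->
  0 <= s -> s <= t -> t <= a ->
  riemannian_dist g (gam s) (gam t) <= L * (t - s).
Proof.
by move=> [_ lg _ _ _] s0 st ta; apply: riemannian_dist_le; exact: lg.
Qed.

Lemma path_abs_continuous a L gam b n : horizontal_path a L gam b n ->
  abs_continuous_curve (riemannian_dist g) a gam.
Proof.
move=> hp; have [[a0 L0] _ _ _ _] := hp; move=> eps eps0.
have L1 : 0 < L + 1 by lra.
exists (eps / (L + 1)); first exact: divr_gt0.
move=> m s t hst _ sum_lt.
apply: (@le_lt_trans _ _ (\sum_(k < m) (L + 1) * (t k - s k))).
  apply: ler_sum => k _; have [s0 st ta] := hst k.
  apply: le_trans (path_dist_le hp s0 st ta) _.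
  by rewrite ler_wpM2r ?subr_ge0//; lra.
by rewrite -mulr_sumr mulrC -ltr_pdivlMr.
Qed.

Lemma path_rectifiable a L gam b n : horizontal_path a L gam b n ->
  rectifiable_curve (riemannian_dist g) a gam.
Proof.
move=> hp; have [[a0 L0] _ _ _ _] := hp; exists (L * a) => m t t0 tS tm.
have mono i j : (i <= j)%N -> (j <= m)%N -> t i <= t j.
  elim: j => [|j IH]; first by rewrite leqn0 => /eqP ->.
  rewrite leq_eqVlt => /predU1P[->//|ij jm].
  exact: le_trans (IH ij (ltnW jm)) (tS _ jm).
apply: (@le_trans _ _ (\sum_(k < m) L * (t k.+1 - t k))).
  apply: ler_sum => k _; have km := ltn_ord k.
  apply: (path_dist_le hp).
  - by apply: le_trans t0 (mono _ _ (leq0n _) (ltnW km)).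
  - exact: tS.
  - exact: le_trans (mono _ _ km (leqnn _)) tm.
rewrite -mulr_sumr ler_wpM2l//.
rewrite -(big_mkord xpredT (fun k => t k.+1 - t k)) telescope_sumr//.
by lra.
Qed.

Lemma frame_in_hor p (i : 'I_N) v : (i < dimH K 1)%N -> frame_dom K p v ->
  frame K p i v \in hor K v.
Proof.
move=> i1 Uv; have [_ _ Xd _ _] := frameP K p; have [_ <-] := Xd v Uv.
apply: memv_span.
have -> : frame K p i v = nth 0 (take (dimH K 1) (frame_at (frame K p) v)) i.
  by rewrite nth_take// -tnth_nth tnth_mktuple.
by rewrite mem_nth// size_take_min leq_min i1 size_tuple ltn_ord.
Qed.

(** The velocity may be missing at the breakpoints, which form a countable set. *)
Lemma path_horizontal a L gam b n : horizontal_path a L gam b n ->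
  horizontal_curve K a gam.
Proof.
move=> [_ _ [b0 bS] bn seg].
have cb : countable (range b) := sub_countable (card_image_le b setT) (countableP _).
exists (range b); split.
- by apply: countable_measurable => // t; exact: measurable_set1.
- exact: countable_lebesgue_measure0.
move=> t /= nt; apply: contrapT => tb; apply: nt; rewrite in_itv/= => /andP[t0 ta].
have [||k /andP[bt tb']] := @breakpoint_between b n t bS.
- by rewrite b0.
- by rewrite bn.
have nb j : t != b j by apply/eqP => tj; apply: tb; exists j.
have tk : t \in `]b k, b k.+1[.
  rewrite in_itv/= !lt_neqAle bt tb' nb andbT/= andbT.
  by rewrite eq_sym nb.
have [p [i [i1 [_ hU hv]]]] := seg k.
have Ut : frame_dom K p (gam t) by apply: hU; exact: subset_itv_oo_cc.
have Xh := frame_in_hor i1 Ut.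
case: hv => /(_ t tk) hv; first by exists (frame K p i (gam t)).
by exists (- frame K p i (gam t)) => //; rewrite memvN.
Qed.

Lemma path_composed a L gam b n : horizontal_path a L gam b n ->
  composed_of_countably_many_segments K a gam.
Proof.
move=> [_ _ [b0 bS] bn seg]; exists b, (fun k => b k.+1).
have mono i j := @breakpoints_le b i j bS.
split=> //.
- apply: ltn_trivIset => j i ij; rewrite -subset0 => r [/=].
  rewrite !in_itv/= => /andP[r1 r2] /andP[r3 r4].
  by have := mono _ _ ij; rewrite leNgt => /negP; apply; lra.
- apply/seteqP; split=> [r [k _]|r] /=; rewrite !in_itv/= => /andP[h1 h2].
    rewrite (le_trans _ h1) -?b0 ?mono//= (le_trans h2)//.
    have [kn|nk] := leqP k.+1 n; first by rewrite -(bn n (leqnn n)) mono.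
    by rewrite bn// ltnW.
  have [||k hk] := @breakpoint_between b n r bS.
  - by rewrite b0.
  - by rewrite bn.
  by exists k => //=; rewrite in_itv.
Qed.

End paths.

Theorem theorem2p8p5 (R : realType) (N : nat) (M : topologicalType)
  (A : smooth_manifold R N M) (g : riemannian_metric A)
  (K : carnot_structure A) (alpha : R)
  (hconn : connected [set: M])
  (halpha : 0 < alpha <= 1)
  (hreg : forall (p : M) (i : 'I_N),
     C1alpha_field g alpha (frame_dom K p) (frame K p i))
  (v w : M) :
  exists (a : R) (gamma : R -> M),
    [/\ 0 <= a, gamma 0 = v & gamma a = w] /\
    [/\ abs_continuous_curve (riemannian_dist g) a gamma,
        rectifiable_curve (riemannian_dist g) a gamma,
        horizontal_curve K a gamma
      & composed_of_countably_many_segments K a gamma].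
Proof.
have [a [L [gam [b [n [gv gw hp]]]]]] := reach_path (reach_all g K hconn v w).
exists a, gam; have [[a0 _] _ _ _ _] := hp; split=> //; split.
- exact: path_abs_continuous hp.
- exact: path_rectifiable hp.
- exact: path_horizontal hp.
- exact: path_composed hp.
Qed.
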